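(* Let $\lambda\in K$ with $|\lambda|>1$ and let $n\ge 2$ be an integer. If $F$ is a two-dimensional map fixing $0$, analytic at $0$, whose Jacobian at $0$ has eigenvalues $\lambda$ and $\lambda^n$, then $F$ is analytically equivalent to its PD-form.
   Context: $K$ is a complete, nontrivially valued non-archimedean field of characteristic $0$ with norm $|\cdot|$. Maps are given by pairs of power series in $K[[x,y]]$ with zero constant term; a map is analytic at $0$ if both series converge on some polydisc containing $0$. Two maps $F,G$ are analytically equivalent if $\Phi\circ F\circ \Phi^{-1}=G$ for some $\Phi$ fixing $0$, analytic at $0$ and locally invertible there. For a map $F$, $[F]^k_{(i,j)}$ denotes the coefficient of $x^iy^j$ in the $k$-th component. PD-form (Poincaré–Dulac form): by a linear change of coordinates one assumes $F(x,y)=(\lambda_1x+O(2),\lambda_2y+O(2))$ with $\lambda_1=\lambda$, $\lambda_2=\lambda^n$ (here $O(2)$ means terms of total degree $\geq 2$). Put $F_1=F$. For $m\ge 2$ let $H_m=\mathrm{Id}+P_m$, where $P_m$ is the homogeneous polynomial map of degree $m$ whose coefficients are, for $i+j=m$ and $k=1,2$, $[H_m]^k_{(i,j)}=[F_{m-1}]^k_{(i,j)}/(\lambda_k-\lambda_1^i\lambda_2^j)$ if the denominator is nonzero and $0$ if the denominator is zero; put $F_m=H_m\circ F_{m-1}\circ H_m^{-1}$. The coefficients of total degree $\leq m$ of $F_m$ do not change in later steps, and the PD-form of $F$ is the limit $F_0$ of the $F_m$. For the present eigenvalues it has the form $F_0(x,y)=(\lambda x,\lambda^n y+bx^n)$ for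 some $b\in K$. *)

(* Defs.v *)
From mathcomp Require Import all_boot all_order all_algebra.
From mathcomp Require Import reals.

Set Implicit Arguments.
Unset Strict Implicit.
Unset Printing Implicit Defensive.

Import Order.TTheory GRing.Theory Num.Theory.
Local Open Scope ring_scope.

(* The library's [normedZmodType] requires `|x *+ n| = `|x| *+ n, which no
   ultrametric norm in characteristic 0 satisfies; hence this record. *)
Record complete_nonarch_norm (R : realType) (K : fieldType) (v : K -> R) :
    Prop := CompleteNonarchNorm {
  nonarch_ge0 : forall x, 0 <= v x;
  nonarch_eq0 : forall x, v x = 0 <-> x = 0;
  nonarchM : forall x y, v (x * y) = v x * v y;
  nonarchD : forall x y, v (x + y) <= Num.max (v x) (v y);
  nonarch_nontrivial : exists2 x, x != 0 & v x != 1;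
  nonarch_complete : forall u : nat -> K,
    (forall e : R, 0 < e ->
      exists N, forall p q, (N <= p)%N -> (N <= q)%N -> v (u p - u q) < e) ->
    exists l, forall e : R, 0 < e ->
      exists N, forall p, (N <= p)%N -> v (u p - l) < e
}.

(* [f i j] is the coefficient of x^i y^j. *)
Definition series2 (K : fieldType) := nat -> nat -> K.

(* [F k i j] is the coefficient of x^i y^j in component k; the components and
   the variables x, y are both indexed by 0, 1 : 'I_2. *)
Definition map2 (K : fieldType) := 'I_2 -> series2 K.

Section FormalMaps.
Variable K : fieldType.
Implicit Types (f g : series2 K) (F G : map2 K) (L : 'M[K]_2).

Definition series_one : series2 K :=
  fun i j => ((i == 0%N) && (j == 0%N))%:R.

Definition series_mul f g : series2 K :=
  fun i j => \sum_(a < i.+1) \sum_(b < j.+1) f a b * g (i - a)%N (j - b)%N.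

Definition series_exp f (n : nat) : series2 K := iter n (series_mul f) series_one.

Definition map_eq F G : Prop := forall k, F k =2 G k.

Definition fixes0 F : Prop := forall k, F k 0%N 0%N = 0.

(* Substitution of G in F, meaningful when G has zero constant term: then
   G_0^a G_1^b has no term of total degree < a + b, so only the pairs with
   a, b <= i + j contribute to the coefficient of x^i y^j. *)
Definition map_comp F G : map2 K := fun k i j =>
  \sum_(a < (i + j).+1) \sum_(b < (i + j).+1)
    F k a b * series_mul (series_exp (G 0) a) (series_exp (G 1) b) i j.

Definition linear_map L : map2 K := fun k i j =>
  if (i == 1%N) && (j == 0%N) then L k 0
  else if (i == 0%N) && (j == 1%N) then L k 1
  else 0.

Definition id_map : map2 K := linear_map 1%:M.

Definition jacobian F : 'M[K]_2 :=
  \matrix_(k, l) (if l == 0 then F k 1%N 0%N else F k 0%N 1%N).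

Definition inverse_maps F G : Prop :=
  [/\ fixes0 F, fixes0 G,
      map_eq (map_comp F G) id_map & map_eq (map_comp G F) id_map].

Definition linear_conj L F : map2 K :=
  map_comp (map_comp (linear_map L) F) (linear_map (invmx L)).

(* H_m = Id + P_m, built from F_{m-1} = F and the eigenvalues mu. *)
Definition PD_step (mu : 'rV[K]_2) (m : nat) F : map2 K := fun k i j =>
  let den := mu 0 k - mu 0 0 ^+ i * mu 0 1 ^+ j in
  id_map k i j +
  (if ((i + j)%N == m) && (den != 0) then F k i j / den else 0).

(* [Fs m] is F_m for m >= 1; [Fs 0] is irrelevant. *)
Definition PD_sequence (mu : 'rV[K]_2) F (Fs : nat -> map2 K) : Prop :=
  map_eq (Fs 1%N) F /\
  forall m, (2 <= m)%N ->
    let H := PD_step mu m (Fs m.-1) in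
    exists2 Hinv, inverse_maps H Hinv &
      map_eq (Fs m) (map_comp (map_comp H (Fs m.-1)) Hinv).

(* Limit of formal maps: every coefficient is eventually constant. *)
Definition formal_limit (Fs : nat -> map2 K) F0 : Prop :=
  forall k i j, exists N, forall m, (N <= m)%N -> Fs m k i j = F0 k i j.

(* F0 is a PD-form of F, with respect to some linear change of coordinates L
   diagonalizing the linear part of F with eigenvalues mu in this order. *)
Definition PD_form (mu : 'rV[K]_2) F F0 : Prop :=
  exists L, [/\ L \in unitmx, jacobian (linear_conj L F) = diag_mx mu &
    exists2 Fs, PD_sequence mu (linear_conj L F) Fs & formal_limit Fs F0].

End FormalMaps.

Section AnalyticMaps.
Variables (R : realType) (K : fieldType) (v : K -> R).
Implicit Types (f : series2 K) (F G : map2 K).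

(* Unconditional convergence, i.e. along the net of finite sets of exponents. *)
Definition converges_at f (x y : K) : Prop :=
  exists S : K, forall e : R, 0 < e ->
    exists N : nat, forall s : seq (nat * nat), uniq s ->
      (forall i j, (i + j <= N)%N -> (i, j) \in s) ->
      v (\sum_(p <- s) f p.1 p.2 * x ^+ p.1 * y ^+ p.2 - S) < e.

Definition analytic_at0 F : Prop :=
  exists r1 r2 : R, [/\ 0 < r1, 0 < r2 &
    forall k x y, v x < r1 -> v y < r2 -> converges_at (F k) x y].

Definition analytically_equivalent F G : Prop :=
  exists Phi Psi : map2 K,
    [/\ analytic_at0 Phi, analytic_at0 Psi, inverse_maps Phi Psi &
        map_eq (map_comp (map_comp Phi F) Psi) G].

End AnalyticMaps.

(* Main.v *)
From HB Require Import structures.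
Require Import Defs.
From mathcomp Require Import all_boot all_order all_algebra.
From mathcomp Require Import boolp reals zify ring lra.

Set Implicit Arguments.
Unset Strict Implicit.
Unset Printing Implicit Defensive.

Import Order.TTheory GRing.Theory Num.Theory.
Local Open Scope ring_scope.

(** Write mu_1 = lambda and mu_2 = lambda^n. After the linear change of
    coordinates L, the map G = L F L^-1 has linear part diag (mu_1, mu_2).

    Formal part. The step H_m = Id + P_m only changes F_(m-1) in degrees >= m,
    and in degree m it subtracts from each coefficient the multiple of P_m that
    kills it, unless mu_k = mu_1^i mu_2^j ([PD_step_conj]). Hence the
    compositions H_m o ... o H_2 stabilize degree by degree to a formal map Phi,
    tangent to the identity, with Phi o G = F0 o Phi ([PD_limit_conj]). Since the
    powers of lambda are distinct, the only resonance in degree >= 2 is x^n in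
    the second component, so F0 = (lambda x, lambda^n y + b x^n) ([PD_shape]).

    Analytic part. Convergence near 0 means that coefficients grow at most
    geometrically. In the conjugacy equation for a component phi of Phi, the
    coefficient of x^i y^j reads
      (mu_k - lambda^(i + n j)) phi_(i,j)
        = sum over a + b < i + j of phi_(a,b) [G_1^a G_2^b]_(i,j) - g_(i,j)
    with g = 0 or g = b phi_1^n. The denominators are not small: off resonance,
    by the ultrametric inequality, |mu_k - lambda^q| = max (|mu_k|, |lambda|^q).
    They are in fact as large as the numerators: if |G_(i,j)| T is at most
    (|lambda| T)^i (|lambda|^n T)^j, then this bound is multiplicative and gives
    |[G_1^a G_2^b]_(i,j)| T^(a+b) <= |lambda|^(i + n j) T^(i+j), because a
    coefficient of G larger than T^(i+j-1) can only come from the linear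
    part, whose factors lambda x and lambda^n y contribute at most i and j
    times. The powers of |lambda| cancel and an induction on i + j yields
    |phi_(i,j)| <= M T^(i+j), where M only has to absorb b and the resonant
    coefficient of phi_2 ([eigen_estimate], [conjugation_geometric]). The same
    kind of induction bounds the inverse of Phi ([inverse_estimate]), and
    Phi o L is the analytic conjugacy.

    Composition of formal maps is handled by making [series2 K] a commutative
    algebra, on which substitution acts by algebra morphisms ([substM]). *)

(* The name [map_comp] alone would denote the lemma [seq.map_comp]. *)
Local Notation map_comp := Defs.map_comp.

(** * The algebra of power series in two variables *)
Section SeriesRing.
Variable K : fieldType.
Implicit Types f g h : series2 K.

Lemma series2P f g : f =2 g -> f = g.
Proof. by move=> e; apply/funext => i; apply/funext => j; apply: e. Qed.

HB.instance Definition _ := gen_eqMixin (series2 K).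
HB.instance Definition _ := gen_choiceMixin (series2 K).

Definition series_zero : series2 K := fun _ _ => 0.
Definition series_add f g : series2 K := fun i j => f i j + g i j.
Definition series_opp f : series2 K := fun i j => - f i j.
Definition series_scale (c : K) f : series2 K := fun i j => c * f i j.

Fact series_addA : associative series_add.
Proof. by move=> f g h; apply: series2P => i j; apply: addrA. Qed.
Fact series_addC : commutative series_add.
Proof. by move=> f g; apply: series2P => i j; apply: addrC. Qed.
Fact series_add0 : left_id series_zero series_add.
Proof. by move=> f; apply: series2P => i j; apply: add0r. Qed.
Fact series_addN : left_inverse series_zero series_opp series_add.
Proof. by move=> f; apply: series2P => i j; apply: addNr. Qed.

HB.instance Definition _ := GRing.isZmodule.Build (series2 K)
  series_addA series_addC series_add0 series_addN.

Lemma coef_seriesD f g i j : (f + g) i j = f i j + g i j. Proof. by []. Qed.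
Lemma coef_seriesN f i j : (- f) i j = - f i j. Proof. by []. Qed.
Lemma coef_seriesB f g i j : (f - g) i j = f i j - g i j. Proof. by []. Qed.

(** A product of series has the same coefficients of low degree as a product of
    truncations; the ring laws of series are read off those of polynomials. *)
Definition poly_agrees N (P : {poly {poly K}}) f :=
  forall i j, (i < N)%N -> (j < N)%N -> P`_i`_j = f i j.

Lemma poly_agrees_trunc N f :
  poly_agrees N (\poly_(i < N) \poly_(j < N) f i j) f.
Proof. by move=> i j iN jN; rewrite coef_poly iN coef_poly jN. Qed.

Lemma poly_agreesM N P Q f g : poly_agrees N P f -> poly_agrees N Q g ->
  poly_agrees N (P * Q) (series_mul f g).
Proof.
move=> Pf Qg i j iN jN; rewrite coefM coef_sum; apply: eq_bigr => a _.
rewrite coefM; apply: eq_bigr => b _; rewrite Pf ?Qg //.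
- exact: leq_ltn_trans (leq_subr _ _) iN.
- exact: leq_ltn_trans (leq_subr _ _) jN.
- exact: leq_ltn_trans (leq_ord _) iN.
- exact: leq_ltn_trans (leq_ord _) jN.
Qed.

Lemma poly_agrees1 N : poly_agrees N 1 (series_one K).
Proof.
by move=> i j _ _; rewrite coef1 /series_one; case: i => [|i];
  rewrite ?coef1 ?coef0.
Qed.

Lemma poly_agrees_inj f g :
  (forall N, exists2 P, poly_agrees N P f & poly_agrees N P g) -> f = g.
Proof.
move=> fg; apply: series2P => i j.
have [P Pf Pg] := fg (i + j).+1.
by rewrite -Pf -?Pg // ltnS ?leq_addr ?leq_addl.
Qed.

Fact series_mulA : associative (@series_mul K).
Proof.
move=> f g h; apply: poly_agrees_inj => N.
have [[Pf Pg] Ph] := (@poly_agrees_trunc N f, @poly_agrees_trunc N g,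
  @poly_agrees_trunc N h).
exists (\poly_(i < N) \poly_(j < N) f i j *
  ((\poly_(i < N) \poly_(j < N) g i j) * \poly_(i < N) \poly_(j < N) h i j)).
  exact/poly_agreesM/poly_agreesM.
by rewrite mulrA; apply/poly_agreesM/Ph/poly_agreesM.
Qed.

Fact series_mulC : commutative (@series_mul K).
Proof.
move=> f g; apply: poly_agrees_inj => N.
have [Pf Pg] := (@poly_agrees_trunc N f, @poly_agrees_trunc N g).
exists (\poly_(i < N) \poly_(j < N) f i j * \poly_(i < N) \poly_(j < N) g i j).
  exact: poly_agreesM.
by rewrite mulrC; apply: poly_agreesM.
Qed.

Fact series_mul1 : left_id (series_one K) (@series_mul K).
Proof.
move=> f; apply: poly_agrees_inj => N.
exists (\poly_(i < N) \poly_(j < N) f i j); last exact: poly_agrees_trunc.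
rewrite -[X in poly_agrees _ X]mul1r.
exact: poly_agreesM (@poly_agrees1 N) (@poly_agrees_trunc N f).
Qed.

Fact series_mulDl : left_distributive (@series_mul K) +%R.
Proof.
move=> f g h; apply: series2P => i j.
rewrite coef_seriesD /series_mul -big_split; apply: eq_bigr => a _.
rewrite -big_split; apply: eq_bigr => b _; exact: mulrDl.
Qed.

Fact series_1neq0 : series_one K != 0.
Proof.
by apply/eqP => /(congr1 (fun f : series2 K => f 0%N 0%N)) /eqP;
  rewrite /= oner_eq0.
Qed.

HB.instance Definition _ := GRing.Zmodule_isComNzRing.Build (series2 K)
  series_mulA series_mulC series_mul1 series_mulDl series_1neq0.

Fact series_scaleA a b f :
  series_scale a (series_scale b f) = series_scale (a * b) f.
Proof. by apply: series2P => i j; apply: mulrA. Qed.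
Fact series_scale1 : left_id 1 series_scale.
Proof. by move=> f; apply: series2P => i j; apply: mul1r. Qed.
Fact series_scaleDr : right_distributive series_scale +%R.
Proof. by move=> a f g; apply: series2P => i j; apply: mulrDr. Qed.
Fact series_scaleDl f : {morph series_scale^~ f : a b / a + b}.
Proof. by move=> a b; apply: series2P => i j; apply: mulrDl. Qed.

HB.instance Definition _ := GRing.Zmodule_isLmodule.Build K (series2 K)
  series_scaleA series_scale1 series_scaleDr series_scaleDl.

Fact series_scaleAl a f g : a *: (f * g) = (a *: f) * g.
Proof.
apply: series2P => i j; rewrite /GRing.scale/= /series_scale mulr_sumr.
apply: eq_bigr => c _; rewrite mulr_sumr; apply: eq_bigr => d _.
exact: mulrA.
Qed.

HB.instance Definition _ :=
  GRing.Lmodule_isLalgebra.Build K (series2 K) series_scaleAl.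
HB.instance Definition _ :=
  GRing.Lalgebra_isComAlgebra.Build K (series2 K).

Lemma coef_seriesZ c f i j : (c *: f) i j = c * f i j. Proof. by []. Qed.
Lemma coef_series1 i j : (1 : series2 K) i j = ((i == 0%N) && (j == 0%N))%:R.
Proof. by []. Qed.
Lemma coef_seriesM f g i j : (f * g) i j =
  \sum_(a < i.+1) \sum_(b < j.+1) f a b * g (i - a)%N (j - b)%N.
Proof. by []. Qed.
Lemma coef_series_sum I (r : seq I) (P : pred I) (f : I -> series2 K) i j :
  (\sum_(k <- r | P k) f k) i j = \sum_(k <- r | P k) f k i j.
Proof. by elim/big_rec2: _ => // k c g _ <-. Qed.

Lemma series_expE f n : series_exp f n = f ^+ n.
Proof. by elim: n => //= n; rewrite exprS => <-. Qed.

End SeriesRing.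

(** * Order of vanishing and congruences *)
Section Order.
Variable K : fieldType.
Implicit Types f g h : series2 K.

Definition ord_ge d f := forall i j, (i + j < d)%N -> f i j = 0.

Lemma ord_ge0 f : ord_ge 0 f. Proof. by []. Qed.

Lemma ord_geW d e f : (d <= e)%N -> ord_ge e f -> ord_ge d f.
Proof. by move=> de fe i j /leq_trans ij; apply/fe/ij. Qed.

Lemma ord_geD d f g : ord_ge d f -> ord_ge d g -> ord_ge d (f + g).
Proof. by move=> fd gd i j ij; rewrite coef_seriesD fd ?gd ?addr0. Qed.

Lemma ord_geN d f : ord_ge d f -> ord_ge d (- f).
Proof. by move=> fd i j ij; rewrite coef_seriesN fd ?oppr0. Qed.

Lemma ord_geB d f g : ord_ge d f -> ord_ge d g -> ord_ge d (f - g).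
Proof. by move=> fd gd; apply/ord_geD/ord_geN. Qed.

Lemma ord_geC d f g : ord_ge d (f - g) -> ord_ge d (g - f).
Proof. by move=> /ord_geN; rewrite opprB. Qed.

Lemma ord_ge_trans d f g h :
  ord_ge d (f - g) -> ord_ge d (g - h) -> ord_ge d (f - h).
Proof. by move=> fg gh; rewrite -(subrKA g); apply: ord_geD. Qed.

Lemma ord_geM d e f g : ord_ge d f -> ord_ge e g -> ord_ge (d + e) (f * g).
Proof.
move=> fd ge i j ij; rewrite coef_seriesM big1 // => a _; rewrite big1 // => b _.
have [ab|ab] := ltnP (a + b) d; first by rewrite fd ?mul0r.
by rewrite ge ?mulr0 //; have := ltn_ord a; have := ltn_ord b; lia.
Qed.

Lemma ord_geX n f : ord_ge 1 f -> ord_ge n (f ^+ n).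
Proof.
move=> f1; elim: n => [|n IHn]; first exact: ord_ge0.
by rewrite exprS -add1n; apply: ord_geM.
Qed.

(** The order a of both series is recorded so that products gain precision:
    replacing a factor by a congruent one is weighted by the order of the
    others. *)
Definition agree_to d a f g :=
  [/\ ord_ge a f, ord_ge a g & ord_ge (d + a) (f - g)].

Lemma agree_toM d a b f f' g g' :
  agree_to d a f f' -> agree_to d b g g' ->
  agree_to d (a + b) (f * g) (f' * g').
Proof.
move=> [fa fa' ff'] [gb gb' gg']; split; try exact: ord_geM.
have -> : f * g - f' * g' = (f - f') * g + f' * (g - g') by ring.
apply: ord_geD; first by rewrite addnA; apply: ord_geM.
by rewrite addnCA; apply: ord_geM.
Qed.

Lemma agree_toX d n f g : agree_to d 1 f g -> agree_to d n (f ^+ n) (g ^+ n).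
Proof.
move=> fg; elim: n => [|n IHn]; first by split=> //; rewrite subrr.
by rewrite !exprS -add1n; apply: agree_toM.
Qed.

End Order.

(** * Substitution and composition *)
Section Substitution.
Variable K : fieldType.
Implicit Types (f g h : series2 K) (F G H : map2 K) (P Q : {poly {poly K}}).

Definition monomial_at G a b : series2 K := G 0 ^+ a * G 1 ^+ b.

Definition subst f G : series2 K := fun i j =>
  \sum_(a < (i + j).+1) \sum_(b < (i + j).+1) f a b * monomial_at G a b i j.

Lemma map_eqP F G : map_eq F G <-> F = G.
Proof.
split=> [FG|->] //; apply/funext => k; apply: series2P; exact: FG.
Qed.

Lemma ord2P (k : 'I_2) : k = 0 \/ k = 1.
Proof. by case: k => -[|[|//]] k; [left|right]; apply: val_inj. Qed.

Lemma map2P F G : F 0 = G 0 -> F 1 = G 1 -> F = G.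
Proof. by move=> FG0 FG1; apply/funext => k; have [->|->] := ord2P k. Qed.

Lemma map_compE F G k : map_comp F G k = subst (F k) G.
Proof.
apply: series2P => i j; apply: eq_bigr => a _; apply: eq_bigr => b _.
by rewrite !series_expE.
Qed.

Lemma fixes0P G : fixes0 G <-> forall k, ord_ge 1 (G k).
Proof.
split=> G0 k; last by rewrite G0.
by case=> [|i] [|j] //; rewrite G0.
Qed.

Lemma ord_monomial G a b : fixes0 G -> ord_ge (a + b) (monomial_at G a b).
Proof. by move/fixes0P => G0; apply: ord_geM; apply: ord_geX. Qed.

Lemma monomial_eq0 G a b i j : fixes0 G -> (i + j < a + b)%N ->
  monomial_at G a b i j = 0.
Proof. by move=> G0; apply: ord_monomial. Qed.

(** The range of summation in [subst] depends on the coefficient (i, j); the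
    widening lemmas give all coefficients a common range, so that sums can be
    exchanged. *)
Lemma sum_ord_widen (t : nat -> K) n N : (n <= N)%N ->
  (forall a, (n <= a)%N -> t a = 0) -> \sum_(a < N) t a = \sum_(a < n) t a.
Proof.
move=> nN t0; rewrite (big_ord_widen N t nN) [RHS]big_mkcond /=.
by apply: eq_bigr => a _; case: ltnP => // /t0.
Qed.

Lemma sum2_ord_widen (t : nat -> nat -> K) n N : (n <= N)%N ->
  (forall a b, (n < a + b)%N -> t a b = 0) ->
  \sum_(a < N.+1) \sum_(b < N.+1) t a b = \sum_(a < n.+1) \sum_(b < n.+1) t a b.
Proof.
move=> nN t0; rewrite (@sum_ord_widen (fun a => \sum_(b < N.+1) t a b) n.+1) //.
  apply: eq_bigr => a _; apply: sum_ord_widen => // b nb.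
  by apply: t0; apply: leq_trans nb (leq_addl _ _).
by move=> a na; rewrite big1 // => b _; apply/t0/leq_trans/leq_addr.
Qed.

Lemma subst_widen f G N i j : fixes0 G -> (i + j <= N)%N ->
  subst f G i j =
    \sum_(a < N.+1) \sum_(b < N.+1) f a b * monomial_at G a b i j.
Proof.
move=> G0 ijN.
rewrite (@sum2_ord_widen (fun a b => f a b * monomial_at G a b i j) (i + j)) //.
by move=> a b ab; rewrite monomial_eq0 ?mulr0.
Qed.

Lemma substD f g G : subst (f + g) G = subst f G + subst g G.
Proof.
apply: series2P => i j; rewrite coef_seriesD -big_split; apply: eq_bigr => a _.
by rewrite -big_split; apply: eq_bigr => b _; rewrite coef_seriesD mulrDl.
Qed.

Lemma substZ c f G : subst (c *: f) G = c *: subst f G.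
Proof.
apply: series2P => i j; rewrite coef_seriesZ mulr_sumr; apply: eq_bigr => a _.
by rewrite mulr_sumr; apply: eq_bigr => b _; rewrite coef_seriesZ mulrA.
Qed.

Lemma substB f g G : subst (f - g) G = subst f G - subst g G.
Proof. by rewrite -scaleN1r substD substZ scaleN1r. Qed.

Lemma subst_ord d f G : fixes0 G -> ord_ge d f -> ord_ge d (subst f G).
Proof.
move=> G0 fd i j ij; rewrite /subst big1 // => a _; rewrite big1 // => b _.
have [ab|ab] := ltnP (a + b) d; first by rewrite fd ?mul0r.
by rewrite monomial_eq0 ?mulr0 //; apply: leq_trans ab.
Qed.

(** The vanishing order a of f improves the precision: a monomial of degree p
    evaluated at G and at G', which agree below degree d + 1, gives values
    agreeing below degree d + p. *)
Lemma subst_agree d a f G G' : fixes0 G -> fixes0 G' -> ord_ge a f ->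
  (forall k, ord_ge d.+1 (G k - G' k)) ->
  ord_ge (d + a) (subst f G - subst f G').
Proof.
move=> G0 G0' fa GG' i j ij; rewrite coef_seriesB /subst -sumrB big1 // => p _.
rewrite -sumrB big1 // => q _; rewrite -mulrBr.
have [pq|pq] := ltnP (p + q) a; first by rewrite fa ?mul0r.
have agr k : agree_to d 1 (G k) (G' k).
  by split; [exact: (fixes0P G).1|exact: (fixes0P G').1|rewrite addn1].
have [_ _ le] := agree_toM (agree_toX p (agr 0)) (agree_toX q (agr 1)).
rewrite -coef_seriesB le ?mulr0 //; apply: leq_trans ij _.
by rewrite leq_add2l.
Qed.

(** Evaluation of polynomials at G is a ring morphism by construction; it agrees
    with [subst] in low degrees, which transfers multiplicativity to series. *)
Definition poly_subst G (P : {poly {poly K}}) : series2 K :=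
  (map_poly (horner_alg (G 1)) P).[G 0].

Lemma coef_poly_subst G P M i j :
  (size P <= M)%N -> (forall a, (size (P`_a)%R <= M)%N) ->
  poly_subst G P i j =
    \sum_(a < M) \sum_(b < M) P`_a`_b * monomial_at G a b i j.
Proof.
move=> sP sPa; rewrite /poly_subst (@horner_coef_wide _ M); last first.
  exact: leq_trans (size_poly _ _) sP.
rewrite coef_series_sum; apply: eq_bigr => a _; rewrite coef_map /=.
rewrite /horner_alg /horner_morph (@horner_coef_wide _ M); last first.
  exact: leq_trans (size_poly _ _) (sPa _).
rewrite mulr_suml coef_series_sum; apply: eq_bigr => b _.
by rewrite coef_map /= -mulrA -scalerAl mul1r [_ * G 0 ^+ a]mulrC.
Qed.

Lemma poly_substP f G N P : fixes0 G -> poly_agrees N P f ->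
  ord_ge N (subst f G - poly_subst G P).
Proof.
move=> G0 Pf i j ij; apply/eqP; rewrite coef_seriesB subr_eq0; apply/eqP.
(* M bounds all degrees present, so both sides are sums over one range *)
pose M := (N + size P + \max_(a < size P) size (P`_a)%R)%N.
have sP : (size P <= M.+1)%N by rewrite /M; lia.
have sPa a : (size (P`_a)%R <= M.+1)%N.
  have [aP|aP] := ltnP a (size P); last by rewrite nth_default ?size_poly0.
  have := @leq_bigmax _ (fun a : 'I_(size P) => size P`_a) (Ordinal aP).
  by rewrite /M /=; lia.
rewrite (coef_poly_subst _ _ _ sP sPa) (@subst_widen _ _ M) //; last first.
  by rewrite /M; lia.
apply: eq_bigr => a _; apply: eq_bigr => b _.
have [ab|ab] := ltnP (i + j) (a + b); first by rewrite monomial_eq0 ?mulr0.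
by rewrite Pf //; lia.
Qed.

Lemma substM f g G : fixes0 G -> subst (f * g) G = subst f G * subst g G.
Proof.
move=> G0; apply: series2P => i j; apply/eqP; rewrite -subr_eq0.
rewrite -coef_seriesB; apply/eqP; set N := (i + j).+1.
have [Pf Qg] := (@poly_agrees_trunc _ N f, @poly_agrees_trunc _ N g).
set P := (\poly_(i < _) _) in Pf; set Q := (\poly_(i < _) _) in Qg.
have fP := poly_substP G0 Pf; have gQ := poly_substP G0 Qg.
have fgPQ := poly_substP G0 (poly_agreesM Pf Qg).
apply: (ord_ge_trans fgPQ) (leqnn _).
have -> : poly_subst G (P * Q) = poly_subst G P * poly_subst G Q.
  by rewrite /poly_subst rmorphM hornerM.
apply: ord_geC; rewrite -[N]addn0.
suff [] : agree_to N (0 + 0) (subst f G * subst g G)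
  (poly_subst G P * poly_subst G Q) by [].
by apply: agree_toM; split; rewrite ?addn0 //; apply: ord_ge0.
Qed.

Lemma coef_subst1 G i j : subst 1 G i j = (1 : series2 K) i j.
Proof.
rewrite /subst !big_ord_recl /= coef_series1 mul1r !big1 ?addr0 //.
- by rewrite /monomial_at !expr0 mulr1.
- by move=> a _; rewrite big1 // => b _; rewrite mul0r.
- by move=> b _; rewrite mul0r.
Qed.

Lemma subst1 G : subst 1 G = 1.
Proof. by apply: series2P => i j; rewrite coef_subst1. Qed.

Lemma substX f G n : fixes0 G -> subst (f ^+ n) G = subst f G ^+ n.
Proof.
by move=> G0; elim: n => [|n IHn]; rewrite ?subst1 // !exprS substM // IHn.
Qed.

Lemma fixes0_comp F G : fixes0 F -> fixes0 G -> fixes0 (map_comp F G).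
Proof.
move=> /fixes0P F0 G0; apply/fixes0P => k; rewrite map_compE.
exact: subst_ord.
Qed.

(** By [substM], monomials in G o H are monomials in G composed with H; the rest
    is an exchange of finite sums, as terms of too high degree vanish. *)
Lemma subst_comp f G H : fixes0 G -> fixes0 H ->
  subst f (map_comp G H) = subst (subst f G) H.
Proof.
move=> G0 H0; apply: series2P => i j; set N := (i + j)%N.
have GH a b : monomial_at (map_comp G H) a b = subst (monomial_at G a b) H.
  by rewrite /monomial_at !map_compE substM // !substX.
transitivity (\sum_(c < N.+1) \sum_(d < N.+1) \sum_(a < N.+1) \sum_(b < N.+1)
    f a b * monomial_at G a b c d * monomial_at H c d i j); last first.
  apply: eq_bigr => c _; apply: eq_bigr => d _.
  have [cd|cd] := leqP (c + d) N; last first.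
    rewrite (monomial_eq0 H0 cd) mulr0 big1 // => a _; rewrite big1 // => b _.
    by rewrite mulr0.
  rewrite (subst_widen _ G0 cd) mulr_suml; apply: eq_bigr => a _.
  by rewrite mulr_suml.
transitivity (\sum_(a < N.+1) \sum_(b < N.+1) \sum_(c < N.+1) \sum_(d < N.+1)
    f a b * monomial_at G a b c d * monomial_at H c d i j).
  apply: eq_bigr => a _; apply: eq_bigr => b _; rewrite GH /subst mulr_sumr.
  apply: eq_bigr => c _; rewrite mulr_sumr; apply: eq_bigr => d _.
  exact: mulrA.
under eq_bigr do rewrite exchange_big /=.
rewrite exchange_big; apply: eq_bigr => c _ /=.
under eq_bigr do rewrite exchange_big /=.
by rewrite exchange_big.
Qed.

Lemma map_compA F G H : fixes0 G -> fixes0 H ->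
  map_comp F (map_comp G H) = map_comp (map_comp F G) H.
Proof.
by move=> G0 H0; apply/funext => k; rewrite !map_compE subst_comp.
Qed.

Definition series_x : series2 K := fun i j => ((i == 1%N) && (j == 0%N))%:R.
Definition series_y : series2 K := fun i j => ((i == 0%N) && (j == 1%N))%:R.

Lemma coef_mulx f i j :
  (series_x * f) i j = if i is i'.+1 then f i' j else 0.
Proof.
rewrite coef_seriesM; case: i => [|i].
  rewrite big1 // => a _; rewrite big1 // => b _.
  by case: a => -[]// ?; rewrite mul0r.
rewrite big_ord_recl big1 ?add0r => [|b _]; last by rewrite mul0r.
rewrite big_ord_recl /= big_ord_recl /= mul1r subn0 subSS subn0.
rewrite [X in _ + X + _]big1 => [|b _]; last by rewrite mul0r.
rewrite big1 ?addr0 // => a _; rewrite big1 // => b _; by rewrite mul0r.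
Qed.

Lemma coef_muly f i j :
  (series_y * f) i j = if j is j'.+1 then f i j' else 0.
Proof.
rewrite coef_seriesM big_ord_recl /=.
rewrite [X in _ + X]big1 ?addr0 => [|a _]; last first.
  by rewrite big1 // => b _; rewrite mul0r.
case: j => [|j].
  by rewrite big_ord1 mul0r.
rewrite big_ord_recl mul0r add0r big_ord_recl /= mul1r subn0 subSS subn0.
by rewrite big1 ?addr0 // => b _; rewrite mul0r.
Qed.

Lemma coef_monomial a b i j :
  (series_x ^+ a * series_y ^+ b) i j = ((i == a) && (j == b))%:R.
Proof.
elim: a i => [|a IHa] i.
  rewrite mul1r; elim: b j => [|b IHb] j; first by [].
  by rewrite exprS coef_muly; case: j => [|j]; rewrite ?IHb ?andbF.
by rewrite exprS -mulrA coef_mulx; case: i => [|i] //; rewrite IHa.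
Qed.

Lemma sum_delta (t : nat -> K) N c : (c < N)%N ->
  \sum_(a < N) (val a == c)%:R * t a = t c.
Proof.
move=> cN; rewrite (bigD1 (Ordinal cN)) //= eqxx mul1r big1 ?addr0 // => a.
by rewrite -val_eqE /= => /negPf ->; rewrite mul0r.
Qed.

Lemma subst_monomial a b G : fixes0 G ->
  subst (series_x ^+ a * series_y ^+ b) G = monomial_at G a b.
Proof.
move=> G0; apply: series2P => i j.
rewrite (@subst_widen _ _ (i + j + a + b)) //; last by lia.
transitivity (\sum_(p < (i + j + a + b).+1) (val p == a)%:R *
    \sum_(q < (i + j + a + b).+1) (val q == b)%:R * monomial_at G p q i j).
  apply: eq_bigr => p _; rewrite mulr_sumr; apply: eq_bigr => q _.
  by rewrite coef_monomial -mulnb natrM mulrA.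
rewrite (@sum_delta (fun p => \sum_(q < (i + j + a + b).+1)
  (val q == b)%:R * monomial_at G p q i j)).
  by rewrite (@sum_delta (fun q => monomial_at G a q i j)) //; lia.
by lia.
Qed.

Lemma subst_x G : fixes0 G -> subst series_x G = G 0.
Proof.
move=> G0; have := subst_monomial 1 0 G0.
by rewrite /monomial_at !expr1 !expr0 !mulr1.
Qed.

Lemma subst_y G : fixes0 G -> subst series_y G = G 1.
Proof.
move=> G0; have := subst_monomial 0 1 G0.
by rewrite /monomial_at !expr1 !expr0 !mul1r.
Qed.

Lemma linear_mapE L k :
  linear_map L k = L k 0 *: series_x + L k 1 *: series_y.
Proof.
apply: series2P => i j; rewrite coef_seriesD !coef_seriesZ /linear_map.
rewrite /series_x /series_y.
by case: i j => [|[|i]] [|[|j]]; rewrite /= ?(mulr0, mulr1, addr0, add0r).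
Qed.

Lemma fixes0_linear (L : 'M[K]_2) : fixes0 (linear_map L).
Proof. by []. Qed.

Lemma id_map0 : id_map K 0 = series_x.
Proof. by rewrite /id_map linear_mapE !mxE scale1r scale0r addr0. Qed.

Lemma id_map1 : id_map K 1 = series_y.
Proof. by rewrite /id_map linear_mapE !mxE scale1r scale0r add0r. Qed.

Lemma fixes0_id : fixes0 (id_map K). Proof. exact: fixes0_linear. Qed.

Lemma monomial_at_id a b i j :
  monomial_at (id_map K) a b i j = ((i == a) && (j == b))%:R.
Proof. by rewrite /monomial_at id_map0 id_map1 coef_monomial. Qed.

Lemma subst_id f : subst f (id_map K) = f.
Proof.
apply: series2P => i j; rewrite /subst.
transitivity (\sum_(p < (i + j).+1) (val p == i)%:R *
    \sum_(q < (i + j).+1) (val q == j)%:R * f p q).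
  apply: eq_bigr => p _; rewrite mulr_sumr; apply: eq_bigr => q _.
  rewrite monomial_at_id -mulnb natrM ![_ == val _]eq_sym; ring.
rewrite (@sum_delta (fun p => \sum_(q < (i + j).+1) (val q == j)%:R * f p q)).
  by rewrite (@sum_delta (fun q => f i q)) //; lia.
by lia.
Qed.

Lemma map_comp_id F : map_comp F (id_map K) = F.
Proof. by apply/funext => k; rewrite map_compE subst_id. Qed.

Lemma map_id_comp G : fixes0 G -> map_comp (id_map K) G = G.
Proof.
by move=> G0; apply: map2P; rewrite map_compE ?id_map0 ?id_map1 ?subst_x ?subst_y.
Qed.

Lemma linear_map_comp L G k : fixes0 G ->
  map_comp (linear_map L) G k = L k 0 *: G 0 + L k 1 *: G 1.
Proof.
by move=> G0; rewrite map_compE linear_mapE substD !substZ subst_x ?subst_y.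
Qed.

End Substitution.

(** * Limits, formal inverses and the Poincare-Dulac procedure *)
Section Congruence.
Variable K : fieldType.
Implicit Types F G H : map2 K.

Definition map_near d F G := forall k, ord_ge d (F k - G k).

Lemma map_near_sym d F G : map_near d F G -> map_near d G F.
Proof. by move=> FG k; apply/ord_geC/FG. Qed.

Lemma map_near_trans d F G H :
  map_near d F G -> map_near d G H -> map_near d F H.
Proof. by move=> FG GH k; apply: ord_ge_trans (FG k) (GH k). Qed.

Lemma map_nearW d e F G : (d <= e)%N -> map_near e F G -> map_near d F G.
Proof. by move=> de FG k; apply: ord_geW de (FG k). Qed.

Lemma map_near_coef d F G k i j :
  map_near d F G -> (i + j < d)%N -> F k i j = G k i j.
Proof.
by move=> FG ij; apply/eqP; rewrite -subr_eq0 -coef_seriesB (FG k).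
Qed.

Lemma map_nearP d F G :
  map_near d F G <-> forall k i j, (i + j < d)%N -> F k i j = G k i j.
Proof.
split=> FG k i j ij; first exact: map_near_coef FG ij.
by rewrite coef_seriesB FG ?subrr.
Qed.

Lemma map_near_fixes0 d F G : map_near d.+1 F G -> fixes0 G -> fixes0 F.
Proof. by move=> FG G0 k; rewrite (map_near_coef k FG) ?G0. Qed.

Lemma fixes0_near1 F G : fixes0 F -> fixes0 G -> map_near 1 F G.
Proof. by move=> /fixes0P F0 /fixes0P G0 k; apply: ord_geB. Qed.

Lemma map_near_comp d F F' G G' : fixes0 F' -> fixes0 G -> fixes0 G' ->
  map_near d F F' -> map_near d G G' ->
  map_near d (map_comp F G) (map_comp F' G').
Proof.
case: d => [|d] // F'0 G0 G'0 FF' GG' k; rewrite !map_compE.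
apply: (@ord_ge_trans _ _ _ (subst (F' k) G)).
  by rewrite -substB; apply: subst_ord.
by rewrite -addn1; apply: subst_agree => //; apply: (fixes0P F').1.
Qed.

Lemma map_near_eq F G : (forall m, map_near m.+2 F G) -> F = G.
Proof.
move=> FG; apply/funext => k; apply: series2P => i j.
by apply: map_near_coef (FG (i + j)) _; lia.
Qed.

(** Sequences are used from index 1 on, with [Fs m] correct below degree
    m + 1; reading the coefficient (i, j) at index i + j + 1 keeps clear of
    index 0. *)
Definition map_limit (Fs : nat -> map2 K) : map2 K :=
  fun k i j => Fs (i + j).+1 k i j.

Lemma map_limit_near (Fs : nat -> map2 K) :
  (forall m, map_near m.+2 (Fs m.+1) (Fs m.+2)) ->
  forall m, map_near m.+2 (map_limit Fs) (Fs m.+1).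
Proof.
move=> near m; apply/map_nearP => k i j ij; rewrite /map_limit.
have [le|le] := leqP (i + j) m.
  rewrite -(subnKC le); elim: (m - (i + j))%N => [|c IHc]; rewrite ?addn0 //.
  by rewrite addnS IHc; apply: map_near_coef (near _) _; lia.
have -> : (i + j = m.+1)%N by lia.
by symmetry; apply: map_near_coef (near _) _; lia.
Qed.

Arguments map_limit_near [Fs] _ _.

(** A right inverse G of F = Id + P is a fixed point of G |-> Id - P o G. As P
    has order 2, this map gains one degree of precision at each iteration. *)
Definition inverse_step F G : map2 K :=
  fun k => id_map K k - subst (F k - id_map K k) G.

Definition inverse_map F : map2 K :=
  map_limit (fun m => iter m (inverse_step F) (id_map K)).

Lemma subst_id_map k G : fixes0 G -> subst (id_map K k) G = G k.
Proof. by move=> G0; rewrite -map_compE map_id_comp. Qed.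

Section Inverse.
Variable F : map2 K.
Hypothesis F_id : map_near 2 F (id_map K).

Lemma fixes0_inverse_step G : fixes0 G -> fixes0 (inverse_step F G).
Proof.
move=> G0; apply/fixes0P => k; apply: ord_geB.
  exact: (fixes0P (id_map K)).1 (@fixes0_id K) k.
by apply: subst_ord => //; apply: ord_geW (F_id k).
Qed.

Lemma inverse_step_near m G G' : fixes0 G -> fixes0 G' ->
  map_near m.+1 G G' ->
  map_near m.+2 (inverse_step F G) (inverse_step F G').
Proof.
move=> G0 G0' GG' k; rewrite /inverse_step opprB addrC subrKA -opprB.
by apply: ord_geN; rewrite -addn2; apply: subst_agree.
Qed.

Lemma fixes0_inverse_iter m : fixes0 (iter m (inverse_step F) (id_map K)).
Proof. elim: m => [|m]; [exact: fixes0_id|exact: fixes0_inverse_step]. Qed.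

Lemma inverse_iter_near m : map_near m.+1
  (iter m (inverse_step F) (id_map K)) (iter m.+1 (inverse_step F) (id_map K)).
Proof.
elim: m => [|m IHm].
  by apply: fixes0_near1; [exact: fixes0_id | exact: (@fixes0_inverse_iter 1)].
exact: inverse_step_near (@fixes0_inverse_iter m) (@fixes0_inverse_iter m.+1) IHm.
Qed.

Lemma inverse_map_near m :
  map_near m.+2 (inverse_map F) (iter m.+1 (inverse_step F) (id_map K)).
Proof. by apply: map_limit_near => {}m; apply: inverse_iter_near. Qed.

Lemma fixes0_inverse_map : fixes0 (inverse_map F).
Proof. exact: map_near_fixes0 (@inverse_map_near 0) (@fixes0_inverse_iter 1). Qed.

Lemma inverse_map_fixpoint : inverse_step F (inverse_map F) = inverse_map F.
Proof.
apply: map_near_eq => m; apply: map_near_trans; last first.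
  exact/map_near_sym/(map_nearW _ (@inverse_map_near m.+1)).
apply: map_nearW (_ : (m.+2 <= m.+3)%N) _ => //.
exact: inverse_step_near fixes0_inverse_map (@fixes0_inverse_iter m.+1)
  (@inverse_map_near m).
Qed.

Lemma inverse_map_right : map_comp F (inverse_map F) = id_map K.
Proof.
apply/funext => k; rewrite map_compE.
have := congr1 (fun G => G k) inverse_map_fixpoint; rewrite /inverse_step.
rewrite substB (subst_id_map _ fixes0_inverse_map) => /eqP.
by rewrite opprB addrA subr_eq addrC (inj_eq (addrI _)) => /eqP.
Qed.

End Inverse.

Lemma inverse_near_id F G d : map_near d.+2 F (id_map K) -> fixes0 G ->
  map_comp F G = id_map K -> map_near d.+2 G (id_map K).
Proof.
move=> F_id G0 FG k; rewrite -[in X in _ - X]FG map_compE.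
by rewrite -{1}(subst_id_map k G0) -substB; apply/subst_ord/ord_geC.
Qed.

(** The right inverse G of F is itself tangent to the identity, so it has a
    right inverse, which must be F. *)
Lemma inverse_mapP F : map_near 2 F (id_map K) -> inverse_maps F (inverse_map F).
Proof.
move=> F_id; have G0 := fixes0_inverse_map F_id; have FG := inverse_map_right F_id.
have G_id := inverse_near_id F_id G0 FG.
have H0 := fixes0_inverse_map G_id; have GH := inverse_map_right G_id.
split=> //; first exact: map_near_fixes0 F_id (@fixes0_id K).
  exact/map_eqP.
apply/map_eqP; rewrite -[RHS]GH; congr map_comp.
by rewrite -[LHS]map_comp_id -GH map_compA // FG map_id_comp.
Qed.

Lemma diag_mapE (mu : 'rV[K]_2) k :
  linear_map (diag_mx mu) k = mu 0 k *: id_map K k.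
Proof.
rewrite /id_map !linear_mapE !mxE scalerDr !scalerA.
by rewrite -[mu 0 k *+ (k == 0)]mulr_natr -[mu 0 k *+ (k == 1)]mulr_natr.
Qed.

Lemma jacobian_near F : fixes0 F -> map_near 2 F (linear_map (jacobian F)).
Proof.
move=> F0; apply/map_nearP => k [|[|i]] [|[|j]] //= _;
  by rewrite /linear_map /= ?mxE ?F0.
Qed.

Lemma near_jacobian F L : map_near 2 F (linear_map L) -> jacobian F = L.
Proof.
move=> FL; apply/matrixP => k l; rewrite mxE.
case: ifP => [/eqP ->|l0]; rewrite (map_near_coef k FL) //= /linear_map //=.
by congr (L k); apply: val_inj; case: l l0 => -[|[|]].
Qed.

Section Diagonal.
Variables (mu : 'rV[K]_2) (G : map2 K).
Hypothesis G_fixes0 : fixes0 G.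
Hypothesis G_diag : map_near 2 G (linear_map (diag_mx mu)).

(** In its lowest degree a + b, the monomial G_1^a G_2^b is that of the linear
    part of G. *)
Lemma coef_monomial_diag a b i j : (i + j <= a + b)%N ->
  monomial_at G a b i j = mu 0 0 ^+ a * mu 0 1 ^+ b * ((i == a) && (j == b))%:R.
Proof.
move=> ij; have agr k : agree_to 1 1 (G k) (linear_map (diag_mx mu) k).
  by split; [exact: (fixes0P G).1|exact: (fixes0P _).1 (@fixes0_linear _ _) _|].
have [_ _ eqm] := agree_toM (agree_toX a (agr 0)) (agree_toX b (agr 1)).
have := eqm i j; rewrite add1n ltnS coef_seriesB => /(_ ij)/eqP.
rewrite subr_eq0 => /eqP; rewrite /monomial_at => ->.
rewrite !diag_mapE !exprZn -scalerAl -scalerAr scalerA coef_seriesZ.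
by rewrite id_map0 id_map1 coef_monomial.
Qed.

(** The only terms of f o G of degree i + j that involve coefficients of f of
    that same degree come from the linear part of G, which is diagonal. *)
Lemma coef_subst_diag f i j : subst f G i j = mu 0 0 ^+ i * mu 0 1 ^+ j * f i j +
  \sum_(a < (i + j).+1) \sum_(b < (i + j).+1 | (a + b < i + j)%N)
    f a b * monomial_at G a b i j.
Proof.
transitivity (\sum_(a < (i + j).+1) \sum_(b < (i + j).+1)
  ((val a == i)%:R * ((val b == j)%:R * (mu 0 0 ^+ i * mu 0 1 ^+ j * f i j)) +
  (if (a + b < i + j)%N then f a b * monomial_at G a b i j else 0))).
  apply: eq_bigr => a _; apply: eq_bigr => b _; case: ltnP => ab.
    have [ai|_] := eqVneq (val a) i; last by rewrite mul0r add0r.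
    have [bj|_] := eqVneq (val b) j; last by rewrite mul0r mulr0 add0r.
    by move: ab; rewrite /= in ai bj; rewrite ai bj ltnn.
  rewrite coef_monomial_diag // addr0 ![_ == val _]eq_sym.
  have [->|_] := eqVneq (val a) i; last by rewrite mul0r !mulr0.
  have [->|_] := eqVneq (val b) j; last by rewrite mul0r !mulr0.
  by rewrite !mul1r mulr1 mulrC.
under eq_bigr do rewrite big_split /=; rewrite big_split /=; congr (_ + _).
  under eq_bigr do rewrite -mulr_sumr.
  rewrite (@sum_delta _ (fun=> \sum_(b < (i + j).+1) (val b == j)%:R * _)).
    by rewrite (@sum_delta _ (fun=> _)) //; lia.
  by lia.
by apply: eq_bigr => a _; rewrite [RHS]big_mkcond.
Qed.

Lemma fixes0_PD_step m : (0 < m)%N -> fixes0 (PD_step mu m G).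
Proof. by case: m => // m _ k; rewrite /PD_step /= addr0. Qed.

Lemma PD_step_near m : map_near m (PD_step mu m G) (id_map K).
Proof.
by apply/map_nearP => k i j ij; rewrite /PD_step ltn_eqF //= addr0.
Qed.

(** Comparing both sides of F' o H = H o G in degree m, with H = Id + P, gives
    F'_(i,j) = G_(i,j) - (mu_k - mu_1^i mu_2^j) P_(i,j). *)
Lemma PD_step_conj m Hinv F' : (2 <= m)%N ->
  inverse_maps (PD_step mu m G) Hinv ->
  F' = map_comp (map_comp (PD_step mu m G) G) Hinv ->
  [/\ fixes0 F', map_near m F' G,
      map_comp F' (PD_step mu m G) = map_comp (PD_step mu m G) G &
      forall k i j, (i + j)%N = m -> mu 0 k - mu 0 0 ^+ i * mu 0 1 ^+ j != 0 ->
        F' k i j = 0].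
Proof.
case: m => [|[|d]] // _; set m := d.+2.
set H := PD_step mu m G; move=> [H0 Hinv0 /map_eqP HHi /map_eqP HiH] F'E.
have H_id : map_near m H (id_map K) := @PD_step_near m.
have Hi_id : map_near m Hinv (id_map K) := inverse_near_id H_id Hinv0 HHi.
have HG0 : fixes0 (map_comp H G) by apply: fixes0_comp.
have F'0 : fixes0 F' by rewrite F'E; apply: fixes0_comp.
have F'G : map_near m F' G.
  rewrite F'E -[X in map_near _ _ X]map_comp_id; apply: map_near_comp => //.
  rewrite -[X in map_near _ _ X]map_id_comp //; apply: map_near_comp => //.
  by apply/map_nearP => k i j ij.
have F'H : map_comp F' H = map_comp H G by rewrite F'E -map_compA // HiH map_comp_id.
split=> // k i j ij den.
have F'_diag : map_near 2 F' (linear_map (diag_mx mu)).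
  exact: map_near_trans (map_nearW _ F'G) G_diag.
have := congr1 (fun F => F k i j) F'H; rewrite !map_compE.
have P0 : ord_ge m (H k - id_map K k) := H_id k.
rewrite -[H k in RHS](subrK (id_map K k)) substD coef_seriesD.
rewrite (subst_id_map _ G_fixes0) coef_subst_diag [X in _ + X + _]big1; last first.
  by move=> a _; rewrite big1 // => b ab; rewrite P0 ?mul0r //; rewrite -ij.
rewrite -[F' k](subrK (linear_map (diag_mx mu) k)) substD coef_seriesD.
have -> : subst (linear_map (diag_mx mu) k) H = mu 0 k *: H k.
  by rewrite diag_mapE substZ subst_id_map.
rewrite coef_seriesZ.
have agr : ord_ge (d.+1 + 2) (subst (F' k - linear_map (diag_mx mu) k) H
    - subst (F' k - linear_map (diag_mx mu) k) (id_map K)).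
  by apply: subst_agree => //; apply: fixes0_id.
have /eqP : (subst (F' k - linear_map (diag_mx mu) k) H
    - subst (F' k - linear_map (diag_mx mu) k) (id_map K)) i j = 0.
  by apply: agr; rewrite addn2 ij.
rewrite coef_seriesB subr_eq0 subst_id => /eqP ->.
have id0 : id_map K k i j = 0.
  by rewrite /id_map linear_mapE coef_seriesD !coef_seriesZ /series_x /series_y;
    move: ij; case: (i) (j) => [|[|?]] [|[|?]] //; rewrite /= !mulr0 addr0.
rewrite !coef_seriesB diag_mapE coef_seriesZ id0 mulr0 !subr0 addr0.
rewrite /H /PD_step ij eqxx den id0 add0r => e.
set p := G k i j / _ in e; rewrite subrK.
have -> : F' k i j = G k i j - (mu 0 k - mu 0 0 ^+ i * mu 0 1 ^+ j) * p.
  by apply: (addIr (mu 0 k * p)); rewrite e; ring.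
by rewrite mulrCA divff // mulr1 subrr.
Qed.

End Diagonal.

Definition PD_iterate mu G m : map2 K := iteri m (fun m' F =>
  if m' is 0%N then G else
  let H := PD_step mu m'.+1 F in map_comp (map_comp H F) (inverse_map H)) G.

Lemma PD_iterateP mu G : PD_sequence mu G (PD_iterate mu G).
Proof.
split=> [|[|[|m]] // _]; first exact/map_eqP.
set H := PD_step _ _ _ => /=; exists (inverse_map H); last exact/map_eqP.
exact/inverse_mapP/(@map_nearW 2 m.+2)/(@PD_step_near _ _ m.+2).
Qed.

Section Sequence.
Variables (mu : 'rV[K]_2) (G : map2 K).
Hypothesis G_fixes0 : fixes0 G.
Hypothesis G_diag : map_near 2 G (linear_map (diag_mx mu)).
Variable Fs : nat -> map2 K.
Hypothesis Fs_PD : PD_sequence mu G Fs.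

Lemma PD_sequence_tangent m :
  fixes0 (Fs m.+1) /\ map_near 2 (Fs m.+1) (linear_map (diag_mx mu)).
Proof.
case: Fs_PD => /map_eqP F1 FS; elim: m => [|m [Fm0 Fm_diag]]; first by rewrite F1.
have [//|/= Hinv Hi /map_eqP FE] := FS m.+2.
have [F0 Fnear _ _] := PD_step_conj Fm0 Fm_diag (isT : (2 <= m.+2)%N) Hi FE.
by split=> //; apply: map_near_trans Fm_diag; apply: map_nearW Fnear.
Qed.

(** The equation is stated with H on the right of F_m to avoid the inverse
    of H. *)
Lemma PD_sequence_step m (H := PD_step mu m.+2 (Fs m.+1)) :
  [/\ map_near m.+2 (Fs m.+1) (Fs m.+2),
      map_comp (Fs m.+2) H = map_comp H (Fs m.+1) &
      forall k i j, (i + j)%N = m.+2 ->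
        mu 0 k - mu 0 0 ^+ i * mu 0 1 ^+ j != 0 -> Fs m.+2 k i j = 0].
Proof.
have [Fm0 Fm_diag] := PD_sequence_tangent m.
have [//|/= Hinv Hi /map_eqP FE] := Fs_PD.2 m.+2.
have [F0 Fnear FH Fnil] := PD_step_conj Fm0 Fm_diag (isT : (2 <= m.+2)%N) Hi FE.
by split=> //; apply: map_near_sym.
Qed.

Lemma PD_sequence_limit : formal_limit Fs (map_limit Fs).
Proof.
move=> k i j; exists (i + j).+1 => -[//|m] ij; symmetry.
apply: map_near_coef (map_limit_near _ m) _; last by lia.
by move=> p; have [] := PD_sequence_step p.
Qed.

(** [PD_conjugation m] is H_m o ... o H_2 for m >= 1. *)
Definition PD_conjugation m : map2 K := iteri m (fun m' Phi =>
  if m' is 0%N then id_map K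
  else map_comp (PD_step mu m'.+1 (Fs m')) Phi) (id_map K).

Lemma PD_conjugationP m : [/\ fixes0 (PD_conjugation m.+1),
  map_near 2 (PD_conjugation m.+1) (id_map K) &
  map_comp (PD_conjugation m.+1) G = map_comp (Fs m.+1) (PD_conjugation m.+1)].
Proof.
elim: m => [|m [Phi0 Phi_id PhiG]].
  split; [exact: fixes0_id|by move=> k i j _; rewrite subrr|].
  by have /map_eqP -> := Fs_PD.1; rewrite map_comp_id map_id_comp.
set Phi := PD_conjugation m.+1 in Phi0 Phi_id PhiG.
have -> : PD_conjugation m.+2 = map_comp (PD_step mu m.+2 (Fs m.+1)) Phi by [].
have H0 : fixes0 (PD_step mu m.+2 (Fs m.+1)) by apply: fixes0_PD_step.
have [_ FH _] := PD_sequence_step m; have [Fm0 _] := PD_sequence_tangent m.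
split; first exact: fixes0_comp.
  rewrite -[X in map_near _ _ X](map_id_comp (@fixes0_id K)).
  apply: map_near_comp => //; try exact: fixes0_id.
  exact: map_nearW (@PD_step_near _ _ _).
by rewrite map_compA // FH -!map_compA // PhiG.
Qed.

(** A coefficient of a composition depends on finitely many coefficients of the
    factors, so Phi_m o G = F_m o Phi_m passes to the limit. *)
Lemma PD_limit_conj F0 : formal_limit Fs F0 -> exists Phi,
  [/\ fixes0 Phi, map_near 2 Phi (id_map K), map_comp Phi G = map_comp F0 Phi,
      map_near 2 F0 (linear_map (diag_mx mu)) &
      forall k i j, (2 <= i + j)%N -> mu 0 k - mu 0 0 ^+ i * mu 0 1 ^+ j != 0 ->
        F0 k i j = 0].
Proof.
move=> limF0.
have -> : F0 = map_limit Fs.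
  apply/funext => k; apply: series2P => i j.
  have [N FN] := limF0 k i j; have [N' FN'] := PD_sequence_limit k i j.
  by rewrite -(FN (maxn N N')) ?FN' ?leq_maxl ?leq_maxr.
have Fs_near m : map_near m.+2 (Fs m.+1) (Fs m.+2) by have [] := PD_sequence_step m.
have F0_near := map_limit_near Fs_near.
have Phi_near m : map_near m.+2 (PD_conjugation m.+1) (PD_conjugation m.+2).
  have [Phi0 _ _] := PD_conjugationP m; apply: map_near_sym.
  rewrite -[X in map_near _ _ X](map_id_comp Phi0) /=.
  apply: map_near_comp => //; first exact: PD_step_near.
  by move=> k i j _; rewrite subrr.
have Phi_lim := map_limit_near Phi_near.
exists (map_limit PD_conjugation).
have [Phi1_0 Phi1_id _] := PD_conjugationP 0.
have Phi0 := map_near_fixes0 (Phi_lim 0) Phi1_0.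
have [F1_0 F1_diag] := PD_sequence_tangent 0.
split=> //.
- apply: map_near_eq => m.
  have [Phim_0 _ PhimG] := PD_conjugationP m; have [Fm_0 _] := PD_sequence_tangent m.
  apply: (@map_near_trans _ _ (map_comp (PD_conjugation m.+1) G)).
    by apply: map_near_comp => // k i j _; rewrite subrr.
  by rewrite PhimG; apply/map_near_sym/map_near_comp.
- exact: map_near_trans (F0_near 0) F1_diag.
move=> k i j; case ij : (i + j)%N => [|[|m]] // _ den.
rewrite (map_near_coef k (F0_near m.+1)); last by rewrite ij.
by have [_ _ ->] := PD_sequence_step m.
Qed.

End Sequence.
End Congruence.

(** * Ultrametric estimates *)
Section Valuation.
Variables (R : realType) (K : fieldType) (v : K -> R).
Hypothesis Kv : complete_nonarch_norm v.
Implicit Types (f g h : series2 K) (F G H : map2 K) (A B C D T U : R).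

Let v_ge0 := nonarch_ge0 Kv.
Let vM := nonarchM Kv.

Lemma v0 : v 0 = 0. Proof. exact/(nonarch_eq0 Kv). Qed.

Lemma v_gt0 x : (0 < v x) = (x != 0).
Proof.
rewrite lt_neqAle v_ge0 andbT eq_sym; congr (~~ _).
by apply/eqP/eqP => /(nonarch_eq0 Kv).
Qed.

Lemma v1 : v 1 = 1.
Proof.
have v1_neq0 : v 1 != 0 by rewrite gt_eqF // v_gt0 oner_eq0.
by apply: (mulfI v1_neq0); rewrite -vM !mulr1.
Qed.

Lemma vX x n : v (x ^+ n) = v x ^+ n.
Proof. by elim: n => [|n IHn]; rewrite ?v1 // !exprS vM IHn. Qed.

Lemma vN x : v (- x) = v x.
Proof.
have /eqP : v (-1) ^+ 2 = 1 by rewrite -vX sqrrN expr1n v1.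
rewrite sqrf_eq1 => /orP[/eqP vN1|/eqP vN1]; first by rewrite -mulN1r vM vN1 mul1r.
by have := v_ge0 (-1); rewrite vN1 ler0N1.
Qed.

Lemma vV x : v x^-1 = (v x)^-1.
Proof.
have [->|x0] := eqVneq x 0; first by rewrite invr0 v0 invr0.
have vx0 : v x != 0 by rewrite gt_eqF // v_gt0.
by apply: (mulfI vx0); rewrite -vM !divff // v1.
Qed.

Lemma vD_le x y B : v x <= B -> v y <= B -> v (x + y) <= B.
Proof. by move=> xB yB; apply: le_trans (nonarchD Kv x y) _; rewrite ge_max xB. Qed.

Lemma vB_le x y B : v x <= B -> v y <= B -> v (x - y) <= B.
Proof. by move=> xB yB; apply: vD_le; rewrite ?vN. Qed.

Lemma vD_lt x y B : v x < B -> v y < B -> v (x + y) < B.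
Proof. by move=> xB yB; apply: le_lt_trans (nonarchD Kv x y) _; rewrite gt_max xB. Qed.

Lemma vB_lt x y B : v x < B -> v y < B -> v (x - y) < B.
Proof. by move=> xB yB; apply: vD_lt; rewrite ?vN. Qed.

Lemma v_sum_le I (r : seq I) (P : pred I) (t : I -> K) B : 0 <= B ->
  (forall i, P i -> v (t i) <= B) -> v (\sum_(i <- r | P i) t i) <= B.
Proof.
move=> B0 tB; elim/big_rec: _ => [|i x Pi xB]; first by rewrite v0.
by apply: vD_le => //; apply: tB.
Qed.

Lemma v_sub_dominant x y : v x < v y -> v (x - y) = v y.
Proof.
move=> xy; apply/le_anti/andP; split; first exact: vB_le (ltW xy) (lexx _).
rewrite leNgt; apply/negP => xyy; by have := vB_lt xy xyy; rewrite subKr ltxx.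
Qed.

Lemma v_sub_pow l p q : 1 < v l -> p != q ->
  v (l ^+ p - l ^+ q) = v l ^+ maxn p q.
Proof.
move=> l1; rewrite neq_ltn => /orP[pq|qp].
  by rewrite v_sub_dominant ?vX ?ltr_eXn2l // (maxn_idPr (ltnW pq)).
by rewrite -vN opprB v_sub_dominant ?vX ?ltr_eXn2l // (maxn_idPl (ltnW qp)).
Qed.

(** With D = 1 this bounds the Gauss norm of f on the polydisc of radii 1/A and
    1/B by 1. The factor D is kept on the left because it multiplies under products:
    a monomial of degree d in series dominated with D is dominated with D^d, and
    this compensates a coefficient of size D^d. *)
Definition dominated A B D f := forall i j, v (f i j) * D <= A ^+ i * B ^+ j.

Section Dominated.
Variables A B : R.
Hypotheses (A0 : 0 <= A) (B0 : 0 <= B).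

Lemma pow_ge0 i j : 0 <= A ^+ i * B ^+ j.
Proof. by rewrite mulr_ge0 ?exprn_ge0. Qed.

Lemma dominatedP D f : 0 < D ->
  dominated A B D f <-> forall i j, v (f i j) <= A ^+ i * B ^+ j / D.
Proof. by move=> D0; split=> fD i j; have := fD i j; rewrite ler_pdivlMr. Qed.

Lemma dominatedM D E f g : 0 < D -> 0 < E ->
  dominated A B D f -> dominated A B E g -> dominated A B (D * E) (f * g).
Proof.
move=> D0 E0 fD gE; apply/dominatedP => [|i j]; first exact: mulr_gt0.
have DE0 : 0 <= A ^+ i * B ^+ j / (D * E).
  by rewrite divr_ge0 ?pow_ge0 ?mulr_ge0 // ltW.
rewrite coef_seriesM; apply: v_sum_le => // a _; apply: v_sum_le => // b _.
rewrite ler_pdivlMr ?mulr_gt0 // vM mulrACA.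
have -> : A ^+ i * B ^+ j = A ^+ a * B ^+ b * (A ^+ (i - a) * B ^+ (j - b)).
  by rewrite mulrACA -!exprD !subnKC ?leq_ord.
by rewrite ler_pM ?mulr_ge0 // ltW.
Qed.

Lemma dominated1 : dominated A B 1 1.
Proof.
move=> i j; rewrite coef_series1 mulr1.
case: i j => [|i] [|j]; rewrite ?v1 ?mulr1 //= ?v0;
  by rewrite ?mul1r ?mulr1 ?mulr_ge0 ?exprn_ge0.
Qed.

Lemma dominatedX D f n : 0 < D ->
  dominated A B D f -> dominated A B (D ^+ n) (f ^+ n).
Proof.
move=> D0 fD; elim: n => [|n IHn]; first exact: dominated1.
by rewrite !exprS; apply: dominatedM; rewrite ?exprn_gt0.
Qed.

Lemma dominated_monomial D G a b : 0 < D -> (forall k, dominated A B D (G k)) ->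
  dominated A B (D ^+ (a + b)) (monomial_at G a b).
Proof.
by move=> D0 GD; rewrite exprD; apply: dominatedM; rewrite ?exprn_gt0 //;
  apply: dominatedX.
Qed.

Lemma dominatedB D f g : 0 < D ->
  dominated A B D f -> dominated A B D g -> dominated A B D (f - g).
Proof.
move=> D0 /(dominatedP _ D0) fD /(dominatedP _ D0) gD.
by apply/(dominatedP _ D0) => i j; apply: vB_le.
Qed.

Lemma dominated_subst D U f G : 0 < D -> 0 < U ->
  dominated U U D f -> (forall k, dominated A B U (G k)) ->
  dominated A B D (subst f G).
Proof.
move=> D0 U0 fD GU; apply/dominatedP => // i j.
have ge0 : 0 <= A ^+ i * B ^+ j / D by rewrite divr_ge0 ?pow_ge0 // ltW.
apply: v_sum_le => // a _; apply: v_sum_le => // b _.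
rewrite ler_pdivlMr // vM mulrAC.
have := fD a b; rewrite -exprD => fab; have := dominated_monomial a b U0 GU i j.
rewrite mulrC; apply: le_trans; exact: ler_wpM2r.
Qed.

End Dominated.

Section EigenEstimate.
Variables (l : K) (n : nat) (mu : 'rV[K]_2) (G : map2 K) (T : R).
Hypotheses (l_gt1 : 1 < v l) (mu0 : mu 0 0 = l) (mu1 : mu 0 1 = l ^+ n).
Hypotheses (G_fixes0 : fixes0 G).
Hypothesis G_diag : map_near 2 G (linear_map (diag_mx mu)).
Hypotheses (T_gt0 : 0 < T)
  (G_dom : forall k, dominated (v l * T) (v l ^+ n * T) T (G k)).

(** The equation expresses (l^p - l^q) f_(i,j), for q = i + n j, through
    coefficients of f of lower degree and g. Its right-hand side is at most
    M |l|^(max p q) T^(i+j), and off resonance |l^p - l^q| = |l|^(max p q). *)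
Lemma eigen_estimate p f g M : 0 <= M -> subst f G = l ^+ p *: f + g ->
  (forall i j, v (g i j) <= M * T ^+ (i + j)) ->
  (forall i j, (i + n * j)%N = p -> v (f i j) <= M * T ^+ (i + j)) ->
  forall i j, v (f i j) <= M * T ^+ (i + j).
Proof.
move=> M0 fG gM res i j; have [N] := ubnP (i + j).
elim: N => // N IHN in i j * => ijN.
have [/eqP|pq] := boolP (i + n * j == p)%N; first exact: res.
set q := (i + n * j)%N in pq.
have l_ge1 : 1 <= v l by apply: ltW.
have MT0 m : 0 <= M * T ^+ m by rewrite mulr_ge0 ?exprn_ge0 // ltW.
have E0 : 0 < v l ^+ maxn p q by rewrite exprn_gt0 // (lt_trans ltr01).
have := congr1 (fun h => h i j) fG.
rewrite (coef_subst_diag G_fixes0 G_diag) coef_seriesD coef_seriesZ.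
rewrite mu0 mu1 -exprM -exprD -/q; set s := \sum_(a < _) _ => e.
have {}e : (l ^+ p - l ^+ q) * f i j = s - g i j.
  rewrite mulrBl; apply: (addIr (l ^+ q * f i j + g i j)).
  by rewrite addrA subrK -e; ring.
rewrite -(ler_pM2r E0) -[in leLHS](v_sub_pow l_gt1) 1?eq_sym // mulrC -vM e.
apply: vB_le; last first.
  apply: le_trans (gM i j) _; rewrite -[leLHS]mulr1.
  by apply: ler_wpM2l => //; apply: exprn_ege1.
have ge0 : 0 <= M * T ^+ (i + j) * v l ^+ maxn p q by rewrite mulr_ge0 // ltW.
apply: v_sum_le => // a _; apply: v_sum_le => // b ab.
have AT0 : 0 <= v l * T by rewrite mulr_ge0 // ltW.
have BT0 : 0 <= v l ^+ n * T by rewrite mulr_ge0 ?exprn_ge0 // ltW.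
have mon := dominated_monomial AT0 BT0 a b T_gt0 G_dom i j.
have fab : v (f a b) <= M * T ^+ (a + b) by apply: IHN; apply: leq_trans ab ijN.
rewrite vM; apply: le_trans (ler_wpM2r (v_ge0 _) fab) _.
rewrite -!mulrA ler_wpM2l // mulrC; apply: le_trans mon _.
rewrite !exprMn mulrACA -exprM -!exprD mulrC -/q.
apply: ler_wpM2l; first by rewrite exprn_ge0 // ltW.
by rewrite ler_eXn2l // leq_maxr.
Qed.

End EigenEstimate.

Lemma dominated_id T k : 0 <= T -> dominated T T T (id_map K k).
Proof.
move=> T0 i j; rewrite /id_map /linear_map !mxE.
have vnat (b : bool) : v b%:R <= 1 by case: b; rewrite ?v1 ?v0.
have [/andP[/eqP-> /eqP->]|_] := ifP; first by rewrite mulr1 ler_piMl.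
have [/andP[/eqP-> /eqP->]|_] := ifP; first by rewrite mul1r ler_piMl.
by rewrite v0 mul0r mulr_ge0 ?exprn_ge0.
Qed.

(** From G = Id - P o G with P of order 2: the coefficients of P o G in a given
    degree only involve the truncation [Gt] of G to lower degrees, whose
    domination is known by induction. *)
Lemma inverse_estimate F G T : 0 < T -> fixes0 G -> map_near 2 F (id_map K) ->
  map_comp F G = id_map K -> (forall k, dominated T T T (F k)) ->
  forall k, dominated T T T (G k).
Proof.
move=> T0 G0 F_id FG F_dom.
have T_ge0 := ltW T0.
have TT i j : 0 <= T ^+ i * T ^+ j by apply: pow_ge0.
have P_dom k : dominated T T T (F k - id_map K k).
  by apply: dominatedB => //; apply: dominated_id.
have GE k : G k = id_map K k - subst (F k - id_map K k) G.
  by rewrite substB (subst_id_map _ G0) -map_compE FG opprB addrC subrK.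
suff GN N : forall k i j, (i + j < N)%N -> v (G k i j) * T <= T ^+ i * T ^+ j.
  by move=> k i j; apply: (GN (i + j).+1).
elim: N => [|[|N] IHN] k i j // ijN.
  by move: ijN; case: i j => [|i] [|j] //; rewrite G0 v0 mul0r.
(* G truncated to the degrees covered by the induction hypothesis *)
pose Gt : map2 K := fun k i j => if (i + j < N.+1)%N then G k i j else 0.
have Gt_near : map_near N.+1 G Gt.
  by apply/map_nearP => k' i' j' ij'; rewrite /Gt ij'.
have Gt0 : fixes0 Gt by apply: map_near_fixes0 (map_near_sym Gt_near) G0.
have Gt_dom k' : dominated T T T (Gt k').
  by move=> i' j'; rewrite /Gt; case: ifP => [/IHN//|_]; rewrite v0 mul0r.
have GGt : ord_ge (N + 2) (subst (F k - id_map K k) G - subst (F k - id_map K k) Gt).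
  exact: subst_agree.
have -> : G k i j = (id_map K k - subst (F k - id_map K k) Gt) i j.
  rewrite [in LHS]GE !coef_seriesB; congr (_ - _).
  by apply/eqP; rewrite -subr_eq0 -coef_seriesB GGt // addn2.
apply: dominatedB => //; first exact: dominated_id.
exact (dominated_subst T_ge0 T_ge0 T0 T0 (P_dom k) Gt_dom).
Qed.

(** This is the coefficient form of convergence on some polydisc, by
    [geometric_analytic] and [analytic_geometric]. *)
Definition geometric f := exists U D, [/\ 1 <= U, 0 < D & dominated U U D f].

Lemma dominated_le A A' D D' f : 0 <= A -> A <= A' -> 0 <= D' -> D' <= D ->
  dominated A A D f -> dominated A' A' D' f.
Proof.
move=> A0 AA' D'0 D'D fD i j; apply: le_trans (_ : v (f i j) * D <= _).
  exact: ler_wpM2l.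
by apply: le_trans (fD i j) _; rewrite ler_pM ?exprn_ge0 // lerXn2r ?nnegrE //;
  apply: le_trans AA'.
Qed.

Lemma geometric_map F : (forall k, geometric (F k)) ->
  exists U D, [/\ 1 <= U, 0 < D & forall k, dominated U U D (F k)].
Proof.
move=> Fg; have [U0 [D0 [U0_ge1 D0_gt0 F0]]] := Fg 0.
have [U1 [D1 [U1_ge1 D1_gt0 F1]]] := Fg 1.
exists (Num.max U0 U1), (Num.min D0 D1); split.
- by rewrite le_max U0_ge1.
- by rewrite lt_min D0_gt0.
have minD : 0 <= Num.min D0 D1 by rewrite le_min !ltW.
move=> k; have [->|->] := ord2P k.
- by apply: dominated_le minD _ F0; rewrite ?(le_trans ler01) ?le_max ?ge_min ?lexx.
- by apply: dominated_le minD _ F1;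
    rewrite ?(le_trans ler01) ?le_max ?ge_min ?lexx ?orbT.
Qed.

(** Without constant term, each coefficient comes with a factor of the radius
    that can absorb any prescribed constant W. *)
Lemma dominated_fixes0 U D W f : 1 <= U -> 0 < D -> 0 < W -> ord_ge 1 f ->
  dominated U U D f -> dominated (U * (1 + W / D)) (U * (1 + W / D)) W f.
Proof.
move=> U1 D0 W0 f0 fD i j; have U0 : 0 <= U := le_trans ler01 U1.
have WD0 : 0 <= W / D by rewrite divr_ge0 ?ltW.
have c0 : 0 <= 1 + W / D by rewrite addr_ge0.
have [ij|ij] := ltnP (i + j) 1.
  by rewrite f0 // v0 mul0r mulr_ge0 ?exprn_ge0 ?mulr_ge0.
have := fD i j; rewrite -!exprD => fij.
apply: le_trans (_ : U ^+ (i + j) * (W / D) <= _).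
  by rewrite mulrA ler_pdivlMr // mulrAC ler_pM2r.
rewrite exprMn ler_wpM2l ?exprn_ge0 //.
apply: le_trans (_ : 1 + W / D <= _); first by rewrite lerDr.
by apply: ler_eXnr => //; rewrite lerDl.
Qed.

Lemma geometric_comp F G : fixes0 G -> (forall k, geometric (F k)) ->
  (forall k, geometric (G k)) -> forall k, geometric (map_comp F G k).
Proof.
move=> G0 Fg Gg k; rewrite map_compE.
have [U [D [U1 D0 FD]]] := geometric_map Fg.
have [U' [D' [U'1 D'0 GD]]] := geometric_map Gg.
have U0 := lt_le_trans ltr01 U1.
have WD0 : 0 <= U / D' by rewrite divr_ge0 ?ltW.
have V1 : 1 <= U' * (1 + U / D') by rewrite mulr_ege1 // lerDl.
exists (U' * (1 + U / D')), D; split=> //.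
have V0 := le_trans ler01 V1.
apply: dominated_subst (U0) (FD k) _ => // k'.
by apply: dominated_fixes0 => //; apply: (fixes0P G).1.
Qed.

(** Coefficients of degree m >= 2 can be bounded by T^(m-1) without a
    multiplicative constant, since U^m / D <= T^(m-1) for T = U^2 (1 + 1/D). *)
Lemma geometric_quadratic F : (forall k, geometric (F k)) -> exists2 T, 1 <= T &
  forall k i j, (2 <= i + j)%N -> v (F k i j) * T <= T ^+ (i + j).
Proof.
move=> /geometric_map[U [D [U1 D0 FD]]].
have D'0 : 0 <= D^-1 by rewrite invr_ge0 ltW.
have U0 := lt_le_trans ltr01 U1.
have c1 : 1 <= 1 + D^-1 by rewrite lerDl.
have T1 : 1 <= U ^+ 2 * (1 + D^-1) by rewrite mulr_ege1 // exprn_ege1.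
exists (U ^+ 2 * (1 + D^-1)) => // k i j ij; set T := U ^+ 2 * _ in T1 *.
have -> : (i + j = (i + j).-2.+2)%N by lia.
rewrite exprSr ler_wpM2r ?(le_trans ler01) //.
have := FD k i j; rewrite -exprD -ler_pdivlMr // => /le_trans; apply.
rewrite /T exprMn -exprM ler_pM ?exprn_ge0 ?(ltW U0) //.
  by rewrite ler_weXn2l //; lia.
by apply: le_trans (ler_eXnr _ c1); rewrite ?lerDr.
Qed.

Lemma pow_unbounded (a B : R) : 1 < a -> exists N, B < a ^+ N.
Proof.
move=> a1; have a0 : 0 < a - 1 by rewrite subr_gt0.
have bern m : m%:R * (a - 1) < a ^+ m.
  elim: m => [|m IHm]; first by rewrite mul0r.
  have am := exprn_ege1 m (ltW a1).
  by rewrite -natr1 exprSr; nra.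
exists (Num.bound (`|B| / (a - 1))); apply: le_lt_trans (bern _).
rewrite -ler_pdivrMr //; apply: le_trans (ltW (archi_boundP _)); last first.
  by rewrite divr_ge0 // ltW.
by rewrite ler_wpM2r ?ler_norm // invr_ge0 ltW.
Qed.

Lemma v_gt1_exists : exists t, 1 < v t.
Proof.
have [x x0 vx1] := nonarch_nontrivial Kv.
have [vx|vx] := ltP 1 (v x); first by exists x.
exists x^-1; rewrite vV invf_gt1 ?v_gt0 //.
by rewrite lt_neqAle vx1.
Qed.

Definition square N : seq (nat * nat) :=
  [seq (i, j) | i <- iota 0 N, j <- iota 0 N].

Lemma mem_square N i j : ((i, j) \in square N) = (i < N)%N && (j < N)%N.
Proof.
apply/allpairsP/andP => [[[a b] [/=]]|[iN jN]].
  by rewrite !mem_iota => aN bN [-> ->].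
by exists (i, j); rewrite !mem_iota.
Qed.

Lemma uniq_square N : uniq (square N).
Proof. by apply: allpairs_uniq; rewrite ?iota_uniq // => -[? ?] [? ?]. Qed.

(** The common terms of the two sums cancel; the ultrametric inequality bounds
    what is left by its largest term. *)
Lemma sum_tail_le (t : nat * nat -> K) N e s s' : 0 <= e -> uniq s -> uniq s' ->
  (forall i j, (i + j <= N)%N -> (i, j) \in s) ->
  (forall i j, (i + j <= N)%N -> (i, j) \in s') ->
  (forall i j, (N < i + j)%N -> v (t (i, j)) <= e) ->
  v (\sum_(p <- s) t p - \sum_(p <- s') t p) <= e.
Proof.
move=> e0 us us' sN s'N te.
rewrite (bigID (mem s')) /= [X in _ - X](bigID (mem s)) /=.
have -> : \sum_(p <- s | p \in s') t p = \sum_(p <- s' | p \in s) t p.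
  rewrite -[LHS]big_filter -[RHS]big_filter; apply: perm_big; apply: uniq_perm.
  - exact: filter_uniq.
  - exact: filter_uniq.
  by move=> p; rewrite !mem_filter andbC.
rewrite opprD addrACA subrr add0r.
apply: vB_le; apply: v_sum_le => // -[i j] ij; apply: te; rewrite ltnNge;
  by apply: contra ij => ?; rewrite ?sN ?s'N.
Qed.

Lemma converges_at_small_terms f x y :
  (forall e : R, 0 < e -> exists N, forall i j, (N < i + j)%N ->
    v (f i j * x ^+ i * y ^+ j) < e) ->
  converges_at v f x y.
Proof.
move=> small; pose t (p : nat * nat) := f p.1 p.2 * x ^+ p.1 * y ^+ p.2.
have sq N p i j : (N <= p)%N -> (i + j <= N)%N -> (i, j) \in square p.+1.
  by rewrite mem_square; lia.
have smallh (e : R) : 0 < e ->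
    exists N, forall i j, (N < i + j)%N -> v (t (i, j)) <= e / 2.
  move=> e0; have [|N tN] := small (e / 2); first by rewrite divr_gt0.
  by exists N => i j ij; apply/ltW/tN.
have half (e : R) : 0 < e -> 0 <= e / 2 < e by move=> e0; lra.
have [S SP] : exists S, forall e : R, 0 < e -> exists N, forall p, (N <= p)%N ->
    v (\sum_(p <- square p.+1) t p - S) < e.
  apply: (@nonarch_complete _ _ _ Kv (fun p => \sum_(p <- square p.+1) t p)) => e e0.
  have [N tN] := smallh e e0; have /andP[e20 e2] := half e e0.
  exists N => p q Np Nq; apply: le_lt_trans e2.
  by apply: (@sum_tail_le _ N) => //; rewrite ?uniq_square // => i j; apply: sq.
exists S => e e0; have [N tN] := smallh e e0; have /andP[e20 e2] := half e e0.
have [N' SN] := SP e e0; exists N => s us sN.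
rewrite -(subrKA (\sum_(p <- square (maxn N N').+1) t p)).
apply: vD_lt; last by apply: SN; apply: leq_maxr.
apply: le_lt_trans e2; apply: (@sum_tail_le t N) => //; rewrite ?uniq_square //.
by move=> i j; apply: sq; apply: leq_maxl.
Qed.

(** On the polydisc of radius 1/(2U) the terms decrease like 2^-(i+j), and in a
    complete ultrametric field terms tending to 0 are summable. *)
Lemma geometric_analytic F : (forall k, geometric (F k)) -> analytic_at0 v F.
Proof.
move=> /geometric_map[U [D [U1 D0 FD]]]; have U0 := lt_le_trans ltr01 U1.
have r0 : 0 < (2 * U)^-1 by rewrite invr_gt0 mulr_gt0.
exists (2 * U)^-1, (2 * U)^-1; split=> // k x y xr yr.
apply: converges_at_small_terms => e e0.
have [N eN] := @pow_unbounded 2 (D^-1 / e) ltac:(lra).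
exists N => i j ij; rewrite !vM !vX.
have small z m : v z < (2 * U)^-1 -> (U * v z) ^+ m <= 2^-1 ^+ m.
  move=> zr; rewrite lerXn2r ?nnegrE ?mulr_ge0 ?invr_ge0 ?(ltW U0) //.
  by move: zr; rewrite invfM => /ltW; rewrite -ler_pdivlMl // mulrC.
have := FD k i j; rewrite -ler_pdivlMr // => fij.
apply: le_lt_trans (_ : 2^-1 ^+ (i + j) / D < _); last first.
  rewrite exprVn; move: eN; rewrite ltr_pdivrMr // => eN.
  rewrite mulrC ltr_pdivrMr ?exprn_gt0 // mulrC; apply: lt_le_trans eN _.
  by rewrite ler_pM2r // ler_weXn2l ?ler1n // ltnW.
rewrite exprD; apply: le_trans (_ : (U * v x) ^+ i * (U * v y) ^+ j / D <= _).
  rewrite !exprMn; apply: le_trans (ler_wpM2r _ (ler_wpM2r _ fij)) _;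
    rewrite ?exprn_ge0 //.
  by rewrite le_eqVlt; apply/orP; left; apply/eqP; ring.
rewrite ler_pM2r ?invr_gt0 // ler_pM ?exprn_ge0 ?mulr_ge0 ?(ltW U0) //; exact: small.
Qed.

(** Partial sums at one point (c, c) with c = t^-m small differ by the single
    term (i, j), which is therefore at most 1 in degree > N; the finitely many
    coefficients of degree <= N are absorbed in the constant B. *)
Lemma analytic_geometric F k : analytic_at0 v F -> geometric (F k).
Proof.
move=> [r1 [r2 [r1_gt0 r2_gt0 conv]]]; have [t t1] := v_gt1_exists.
have t0 : 0 < v t := lt_trans ltr01 t1.
have [m tm] := pow_unbounded (Num.max r1^-1 r2^-1) t1.
move: tm; rewrite gt_max => /andP[tm1 tm2].
have tm0 : 0 < v t ^+ m by rewrite exprn_gt0.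
have c1 : v (t ^- m) < r1 by rewrite vV vX invf_plt ?posrE.
have c2 : v (t ^- m) < r2 by rewrite vV vX invf_plt ?posrE.
have [S SP] := conv k _ _ c1 c2; have [N SN] := SP 1 ltr01.
pose B := \sum_(i < N.+1) \sum_(j < N.+1) v (F k i j).
have B0 : 0 <= B by rewrite sumr_ge0 // => i _; rewrite sumr_ge0.
have B1 : 1 <= 1 + B by rewrite lerDl.
have U1 : 1 <= v t ^+ m by rewrite exprn_ege1 // ltW.
exists (v t ^+ m), (1 + B)^-1; split=> //.
  by rewrite invr_gt0 (lt_le_trans ltr01).
move=> i j; rewrite -exprD ler_pdivrMr ?(lt_le_trans ltr01) //.
have Uij : 1 <= (v t ^+ m) ^+ (i + j) by rewrite exprn_ege1.
have [ij|ij] := leqP (i + j) N.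
  have iN : (i < N.+1)%N by apply: leq_trans (leq_addr j i) _.
  have jN : (j < N.+1)%N by apply: leq_trans (leq_addl i j) _.
  apply: le_trans (_ : B <= _); last first.
    by apply: le_trans (ler_wpM2r _ Uij); rewrite ?mul1r ?lerDr ?(le_trans ler01).
  rewrite /B (bigD1 (Ordinal iN)) //= (bigD1 (Ordinal jN)) //= -addrA lerDl.
  rewrite addr_ge0 ?sumr_ge0 // => a _; by rewrite sumr_ge0.
pose s := [seq p <- square N.+1 | (p.1 + p.2 <= N)%N].
have us : uniq s by rewrite filter_uniq // uniq_square.
have sN a b : (a + b <= N)%N -> (a, b) \in s.
  by move=> ab; rewrite mem_filter /= ab mem_square !ltnS !(leq_trans _ ab)
    ?leq_addr ?leq_addl.
have ijs : uniq ((i, j) :: s) by rewrite cons_uniq us andbT mem_filter /= leqNgt ij.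
have ijsN a b : (a + b <= N)%N -> (a, b) \in (i, j) :: s.
  by move=> ab; rewrite in_cons sN ?orbT.
have := vB_lt (SN _ ijs ijsN) (SN _ us sN).
rewrite big_cons opprB addrA subrK addrK /= !vM !vX !vV vX -mulrA -exprD.
rewrite exprVn ltr_pdivrMr ?exprn_gt0 // mul1r => /ltW/le_trans; apply.
by rewrite ler_peMr // exprn_ge0 // ltW.
Qed.

End Valuation.

(** * Diagonalization of the linear part *)
Section Linear.
Variable K : fieldType.
Implicit Types (F G : map2 K) (L M : 'M[K]_2).

Lemma linear_mapM L M :
  map_comp (linear_map L) (linear_map M) = linear_map (L *m M).
Proof.
apply/funext => k; rewrite linear_map_comp // !linear_mapE !mxE !big_ord_recl.
rewrite !big_ord0 !addr0 (_ : lift ord0 ord0 = 1); last exact: val_inj.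
by rewrite !scalerDr !scalerA !scalerDl addrACA.
Qed.

Lemma jacobian_linear_conj L F : fixes0 F ->
  jacobian (linear_conj L F) = L *m jacobian F *m invmx L.
Proof.
move=> F0; apply: near_jacobian; rewrite -!linear_mapM.
apply: map_near_comp => //; try by move=> k i j _; rewrite subrr.
  exact: fixes0_comp.
apply: map_near_comp => //; first by move=> k i j _; rewrite subrr.
exact: jacobian_near.
Qed.

Lemma fixes0_linear_conj L F : fixes0 F -> fixes0 (linear_conj L F).
Proof. by move=> F0; do !apply: fixes0_comp. Qed.

(** Eigenvalues are those of row vectors, so the rows of L are eigenvectors. *)
Lemma eigen_diagonalization (A : 'M[K]_2) a b : a != b ->
  eigenvalue A a -> eigenvalue A b ->
  exists2 L, L \in unitmx & L *m A = diag_mx (\row_k if k == 0 then a else b) *m L.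
Proof.
move=> ab /eigenvalueP[u uA u0] /eigenvalueP[w wA w0].
pose L : 'M[K]_2 := \matrix_(k, j) if k == 0 then u 0 j else w 0 j.
have rowL k : row k L = if k == 0 then u else w.
  by apply/rowP => j; rewrite !mxE; case: ifP.
exists L; last first.
  apply/row_matrixP => k; rewrite row_mul rowL mul_diag_mx; apply/rowP => j.
  by case: eqP => k0; rewrite ?uA ?wA !mxE; case: eqP k0.
rewrite -row_free_unit; apply/inj_row_free => c.
have cL M : c *m (M : 'M[K]_2) = c 0 0 *: row 0 M + c 0 1 *: row 1 M.
  rewrite mulmx_sum_row !big_ord_recl big_ord0 addr0.
  by rewrite (_ : lift ord0 ord0 = 1) //; apply: val_inj.
rewrite cL !rowL /= => cuw.
(* applying A - a to a relation between u and w kills u *)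
have := congr1 (fun x => x *m A - a *: x) cuw.
rewrite mulmxDl -!scalemxAl uA wA mul0mx scaler0 subr0 scalerDr !scalerA.
rewrite [a * _]mulrC opprD addrACA subrr add0r -scalerBl [a * _]mulrC -mulrBr.
move=> /eqP; rewrite scaler_eq0 (negPf w0) orbF mulf_eq0 subr_eq0 [b == a]eq_sym.
rewrite (negPf ab) orbF => /eqP c1.
move: cuw => /eqP; rewrite c1 scale0r addr0 scaler_eq0 (negPf u0) orbF => /eqP c0.
by apply/rowP => k; rewrite mxE; have [->|->] := ord2P k.
Qed.

End Linear.

(** * The conjugacy to the Poincare-Dulac form *)
Section Resonance.
Variables (R : realType) (K : fieldType) (v : K -> R).
Hypothesis Kv : complete_nonarch_norm v.

Lemma dominated_near (T A B : R) (G : map2 K) (L : 'M[K]_2) :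
  1 <= T -> T <= A -> T <= B -> fixes0 G -> map_near 2 G (linear_map L) ->
  (forall k i j, (2 <= i + j)%N -> v (G k i j) * T <= T ^+ (i + j)) ->
  (forall k, v (L k 0) * T <= A) -> (forall k, v (L k 1) * T <= B) ->
  forall k, dominated v A B T (G k).
Proof.
move=> T1 TA TB G0 GL Gq LA LB k i j.
have T0 : 0 <= T := le_trans ler01 T1.
have [ij|ij] := ltnP (i + j) 2; last first.
  apply: le_trans (Gq k i j ij) _; rewrite exprD ler_pM ?exprn_ge0 //.
    by rewrite lerXn2r ?nnegrE ?(le_trans T0).
  by rewrite lerXn2r ?nnegrE ?(le_trans T0).
rewrite (map_near_coef k GL ij) /linear_map.
case: i j ij => [|[|i]] [|[|j]] //= _; rewrite ?mulr1 ?mul1r //.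
by rewrite (v0 Kv) mul0r.
Qed.

Lemma geometric_linear (L : 'M[K]_2) k : geometric v (linear_map L k).
Proof.
pose B := v (L k 0) + v (L k 1).
have [v0' v1'] : 0 <= v (L k 0) /\ 0 <= v (L k 1).
  by split; apply: (nonarch_ge0 Kv).
have B1 : 0 < 1 + B by rewrite /B; lra.
exists 1, (1 + B)^-1; split=> //; first by rewrite invr_gt0.
move=> i j; rewrite !expr1n mulr1 ler_pdivrMr // mul1r /linear_map /B.
by do 2 (case: ifP => _; first by lra); rewrite (v0 Kv); lra.
Qed.

Lemma inverse_geometric (F G : map2 K) :
  fixes0 F -> fixes0 G -> map_near 2 F (id_map K) ->
  map_comp F G = id_map K -> (forall k, geometric v (F k)) ->
  forall k, geometric v (G k).
Proof.
move=> F0 G0 F_id FG Fg k; have [T T1 FT] := geometric_quadratic Kv Fg.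
have T0 : 0 < T := lt_le_trans ltr01 T1.
exists T, T; split=> //; apply: (inverse_estimate Kv T0 G0 F_id FG) => k'.
by apply: (dominated_near T1 _ _ F0 F_id FT) => // k2;
  rewrite mxE; case: eqP => _; rewrite ?(v0 Kv) ?(v1 Kv) ?mul0r ?mul1r // ltW.
Qed.

Variables (l : K) (n : nat).
Hypotheses (l_gt1 : 1 < v l) (n_ge2 : (2 <= n)%N).
Let mu : 'rV[K]_2 := \row_k (if k == 0 then l else l ^+ n).

Lemma pow_inj p q : l ^+ p = l ^+ q -> p = q.
Proof.
move=> /(congr1 v); rewrite !(vX Kv).
by apply: ieexprIn; rewrite ?gt_eqF // (lt_trans ltr01).
Qed.

(** A resonance in degree >= 2 needs i + n j = 1, impossible, in the first
    component, and i + n j = n, that is (i, j) = (n, 0), in the second. *)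
Lemma PD_shape (F0 : map2 K) : map_near 2 F0 (linear_map (diag_mx mu)) ->
  (forall k i j, (2 <= i + j)%N -> mu 0 k - mu 0 0 ^+ i * mu 0 1 ^+ j != 0 ->
    F0 k i j = 0) ->
  F0 0 = l *: series_x K /\
  F0 1 = l ^+ n *: series_y K + F0 1 n 0%N *: series_x K ^+ n.
Proof.
have xn i j : (series_x K ^+ n) i j = ((i == n) && (j == 0%N))%:R.
  by rewrite -[series_x K ^+ n]mulr1 -(expr0 (series_y K)) coef_monomial.
have mu0 : mu 0 0 = l by rewrite mxE.
have mu1 : mu 0 1 = l ^+ n by rewrite mxE.
move=> F0_diag res; split; apply: series2P => i j.
  have [ij|ij] := ltnP (i + j) 2.
    rewrite (map_near_coef 0 F0_diag ij) diag_mapE coef_seriesZ mu0.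
    by rewrite id_map0.
  rewrite res //; last first.
    rewrite mu0 mu1 -exprM -exprD subr_eq0 -[X in X == _]expr1.
    apply/eqP => /pow_inj e; move: ij e; case: j => [|j]; first by lia.
    by move: n_ge2; case: (n) => [|[|m]] // _; lia.
  rewrite coef_seriesZ /series_x.
  by move: ij; case: i j => [|[|i]] [|[|j]]; rewrite //= mulr0.
rewrite coef_seriesD !coef_seriesZ xn.
have [ij|ij] := ltnP (i + j) 2.
  rewrite (map_near_coef 1 F0_diag ij) diag_mapE coef_seriesZ mu1 id_map1.
  rewrite (_ : (i == n) && (j == 0%N) = false) ?mulr0 ?addr0 //.
  by apply/negP => /andP[/eqP iE _]; move: ij n_ge2; rewrite iE; lia.
rewrite (_ : series_y K i j = 0) ?mulr0 ?add0r; last first.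
  by rewrite /series_y; move: ij; case: i j => [|[|i]] [|[|j]].
have [/andP[/eqP-> /eqP->]|ij'] := boolP ((i == n) && (j == 0%N)).
  by rewrite mulr1.
rewrite mulr0 res // mu0 mu1 -exprM -exprD subr_eq0.
apply: contra ij' => /eqP /pow_inj e; move: ij e; case: j => [|j]; first lia.
by move: n_ge2; case: (n) => [|[|m]] // _; lia.
Qed.

(** Each component is an instance of [eigen_estimate]: first phi_1, with no
    inhomogeneous term and resonance only at its linear term, then phi_2, where
    the bound on phi_1^n follows from the one on phi_1. *)
Lemma conjugation_geometric (G Phi : map2 K) (b : K) :
  fixes0 G -> map_near 2 G (linear_map (diag_mx mu)) ->
  (forall k, geometric v (G k)) -> map_near 2 Phi (id_map K) ->
  subst (Phi 0) G = l *: Phi 0 ->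
  subst (Phi 1) G = l ^+ n *: Phi 1 + b *: Phi 0 ^+ n ->
  forall k, geometric v (Phi k).
Proof.
move=> G0 G_diag Gg Phi_id Phi0G Phi1G.
have mu0 : mu 0 0 = l by rewrite mxE.
have mu1 : mu 0 1 = l ^+ n by rewrite mxE.
have [T T1 GT] := geometric_quadratic Kv Gg.
have T0 : 0 < T := lt_le_trans ltr01 T1.
have T_ge0 := ltW T0.
have l1 : 1 <= v l := ltW l_gt1.
have ln1 : 1 <= v l ^+ n by rewrite exprn_ege1.
have diag_le k c : v (diag_mx mu k c) <= v (mu 0 c).
  by rewrite mxE; case: eqP => [<-|_] //; rewrite mulr0n (v0 Kv) (nonarch_ge0 Kv).
have G_dom k : dominated v (v l * T) (v l ^+ n * T) T (G k).
  apply: (dominated_near T1 _ _ G0 G_diag GT) => [||k'|k'].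
  - by rewrite ler_peMl.
  - by rewrite ler_peMl.
  - by rewrite ler_wpM2r // -mu0.
  - by rewrite ler_wpM2r // -(vX Kv) -mu1.
have est := eigen_estimate Kv l_gt1 mu0 mu1 G0 G_diag T0 G_dom.
have Phi0T i j : v (Phi 0 i j) <= 1 * T ^+ (i + j).
  apply: (est 1%N _ 0) => // [|i' j'|i' j' e].
  - by rewrite expr1 addr0.
  - by rewrite (v0 Kv) mul1r exprn_ge0.
  have [-> ->] : i' = 1%N /\ j' = 0%N.
    by move: n_ge2 e; case: (n) => [|[|m]] //; case: j' => [|j'] _; lia.
  rewrite (map_near_coef 0 Phi_id) // id_map0 /series_x (v1 Kv) mul1r.
  by rewrite exprn_ege1.
(* v b bounds the inhomogeneous term, v (Phi 1 n 0) the resonant one *)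
pose M := Num.max 1 (Num.max (v b) (v (Phi 1 n 0%N))).
have M1 : 1 <= M by rewrite le_max lexx.
have Mb : v b <= M by rewrite !le_max lexx orbT.
have MPhi : v (Phi 1 n 0%N) <= M by rewrite !le_max lexx !orbT.
have M0 : 0 <= M := le_trans ler01 M1.
have Phi1T i j : v (Phi 1 i j) <= M * T ^+ (i + j).
  apply: (est n _ _ M M0 Phi1G) => // i' j'.
    rewrite coef_seriesZ (nonarchM Kv) ler_pM ?(nonarch_ge0 Kv) //.
    have Phi0_dom : dominated v T T 1 (Phi 0).
      by move=> i2 j2; rewrite mulr1 -exprD -[leRHS]mul1r.
    have := dominatedX Kv T_ge0 T_ge0 n ltr01 Phi0_dom i' j'.
    by rewrite expr1n mulr1 exprD.
  move=> e; have [[-> ->]|[-> ->]] :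
      (i' = n /\ j' = 0%N) \/ (i' = 0%N /\ j' = 1%N).
    move: n_ge2 e; case: (n) => [|[|m]] //; case: j' => [|[|j']] _; lia.
    apply: le_trans MPhi _; rewrite addn0 -[leLHS]mulr1 ler_wpM2l //.
    exact: exprn_ege1.
  rewrite (map_near_coef 1 Phi_id) // id_map1 /series_y (v1 Kv).
  by rewrite mulr_ege1 // exprn_ege1.
move=> k; exists T, M^-1; split=> //.
  by rewrite invr_gt0 (lt_le_trans ltr01).
move=> i j; rewrite -exprD ler_pdivrMr ?(lt_le_trans ltr01) // mulrC.
have [->|->] := ord2P k.
- by apply: le_trans (Phi0T i j) _; rewrite ler_wpM2r // exprn_ge0.
- exact: Phi1T.
Qed.

End Resonance.

Theorem proposition4p3 (R : realType) (K : fieldType) (v : K -> R)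
    (Kv : complete_nonarch_norm v) (charK : [pchar K] =i pred0)
    (lambda : K) (n : nat) (F : map2 K)
    (lambda_gt1 : 1 < v lambda) (n_ge2 : (2 <= n)%N)
    (F_fixes0 : fixes0 F) (F_analytic : analytic_at0 v F)
    (F_eig1 : eigenvalue (jacobian F) lambda)
    (F_eig2 : eigenvalue (jacobian F) (lambda ^+ n)) :
  let mu : 'rV[K]_2 := \row_k (if k == 0 then lambda else lambda ^+ n) in
  (exists F0 : map2 K, PD_form mu F F0) /\
  (forall F0 : map2 K, PD_form mu F F0 -> analytically_equivalent v F F0).
Proof.
move=> mu; split.
  have neq : lambda != lambda ^+ n.
    apply/eqP; rewrite -{1}[lambda]expr1 => /(pow_inj Kv lambda_gt1) n1.
    by move: n_ge2; rewrite -n1.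
  have [L L_unit LJ] := eigen_diagonalization neq F_eig1 F_eig2.
  have G0 := fixes0_linear_conj L F_fixes0.
  have jG : jacobian (linear_conj L F) = diag_mx mu.
    by rewrite jacobian_linear_conj // LJ mulmxK.
  have G_diag := jacobian_near G0; rewrite jG in G_diag.
  exists (map_limit (PD_iterate mu (linear_conj L F))), L; split=> //.
  have Fs_PD := PD_iterateP mu (linear_conj L F).
  by exists (PD_iterate mu (linear_conj L F)) => //; apply: PD_sequence_limit Fs_PD.
move=> F0 [L [L_unit jG [Fs Fs_PD limF0]]].
have G0 := fixes0_linear_conj L F_fixes0; set G := linear_conj L F in G0 jG Fs_PD.
have G_diag := jacobian_near G0; rewrite jG in G_diag.
have [Phi [Phi0 Phi_id PhiG F0_diag F0_res]] :=
  PD_limit_conj G0 G_diag Fs_PD limF0.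
have [F0E0 F0E1] := PD_shape Kv lambda_gt1 n_ge2 F0_diag F0_res.
set b := F0 1 n 0%N in F0E1.
have Fg k : geometric v (F k) := analytic_geometric Kv k F_analytic.
have L0 := @fixes0_linear K L; have L'0 := @fixes0_linear K (invmx L).
have LFg := geometric_comp Kv F_fixes0 (geometric_linear Kv L) Fg.
have Gg := geometric_comp Kv L'0 LFg (geometric_linear Kv (invmx L)).
have Phig : forall k, geometric v (Phi k).
  apply: (conjugation_geometric Kv lambda_gt1 n_ge2 G0 G_diag Gg Phi_id (b := b)).
    by rewrite -map_compE PhiG map_compE F0E0 substZ subst_x.
  rewrite -map_compE PhiG map_compE F0E1 substD !substZ subst_y // substX //.
  by rewrite subst_x.
have [_ Psi0 /map_eqP PhiPsi /map_eqP PsiPhi] := inverse_mapP Phi_id.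
set Psi := inverse_map Phi in Psi0 PhiPsi PsiPhi.
have Psig := inverse_geometric Kv Phi0 Psi0 Phi_id PhiPsi Phig.
have LL' : map_comp (linear_map L) (linear_map (invmx L)) = id_map K.
  by rewrite linear_mapM mulmxV.
have L'L : map_comp (linear_map (invmx L)) (linear_map L) = id_map K.
  by rewrite linear_mapM mulVmx.
exists (map_comp Phi (linear_map L)), (map_comp (linear_map (invmx L)) Psi).
have L'Psi0 : fixes0 (map_comp (linear_map (invmx L)) Psi) by apply: fixes0_comp.
split.
- apply: (geometric_analytic Kv).
  exact: geometric_comp L0 Phig (geometric_linear Kv L).
- apply: (geometric_analytic Kv).
  exact: geometric_comp Psi0 (geometric_linear Kv (invmx L)) Psig.
- split; [exact: fixes0_comp|exact: fixes0_comp| |]; apply/map_eqP.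
    by rewrite -map_compA // (map_compA _ L'0) // LL' map_id_comp.
  rewrite -map_compA //; last exact: fixes0_comp.
  by rewrite (map_compA _ Phi0) // PsiPhi map_id_comp.
have -> : F0 = map_comp (map_comp Phi G) Psi.
  by rewrite PhiG -map_compA // PhiPsi map_comp_id.
have LF0 : fixes0 (map_comp (linear_map L) F) by apply: fixes0_comp.
apply/map_eqP; rewrite /G /linear_conj -(map_compA _ L0 F_fixes0).
by rewrite (map_compA _ L'0 Psi0) (map_compA _ LF0 L'0).
Qed.
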